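(* Let $\mathcal I$ be an at most countably infinite alphabet and let $(\Sigma_A,\sigma)$ be the one-sided topological Markov shift over $\mathcal I$ with transition matrix $A$; assume it is topologically mixing and admits a Gibbs measure $\mu$ with respect to a locally Hölder potential $\phi:\Sigma_A\to\mathbb R$. For $\underline x\in\Sigma_A$ and $n\ge 2$ let $$M_n(\underline x)=\max\{k:\ \exists\, 0\le i<j\le n-1 \text{ with } x_i=x_j,\ x_{i+1}=x_{j+1},\dots,x_{i+k-1}=x_{j+k-1}\}.$$ Then $$\lim_{n\to+\infty}\frac{M_n(\underline x)}{\log n}=\frac{2}{H_2}$$ for $\mu$-almost every $\underline x\in\Sigma_A$, where $H_2=H_2(\mu)$ is the Rényi entropy of $\mu$.
   Context: $A=(A_{a,b})_{a,b\in\mathcal I}$ is a matrix with entries in $\{0,1\}$, $\Sigma_A=\{\underline x=(x_0,x_1,\dots): x_i\in\mathcal I,\ A_{x_i,x_{i+1}}=1 \text{ for all } i\ge 0\}$, and $\sigma(x_0,x_1,\dots)=(x_1,x_2,\dots)$. A $k$-cylinder is a (nonempty) set $[x_0,\dots,x_{k-1}]=\{\underline y\in\Sigma_A: y_i=x_i,\ 0\le i\le k-1\}$; $\mathcal C_k$ is the set of all $k$-cylinders and $C_k(\underline x)$ is the $k$-cylinder containing $\underline x$. The $\sigma$-algebra is the one generated by cylinders. Topologically mixing: for all $a,b\in\mathcal I$ there is $n_0$ such that $[a]\cap\sigma^{-n}[b]\ne\emptyset$ for all $n>n_0$. Locally Hölder: there are $M_\phi>0$, $\zeta\in(0,1)$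 with $\sup\{|\phi(\underline x)-\phi(\underline y)|: x_i=y_i \ \forall i\le k-1\}\le M_\phi\zeta^k$ for all $k\ge1$. Gibbs measure for $\phi$: a $\sigma$-invariant probability measure $\mu$ for which there are constants $c_\phi>0$, $P\in\mathbb R$ such that for all $m\in\mathbb N$ and all $\underline x\in\Sigma_A$, $c_\phi^{-1}\le \dfrac{\mu(C_m(\underline x))}{\exp(-mP+S_m\phi(\underline x))}\le c_\phi$, where $S_m\phi=\sum_{i=0}^{m-1}\phi\circ\sigma^i$. Rényi entropy: $H_2(\mu)=\lim_{n\to\infty}\frac{\log\sum_{C\in\mathcal C_n}\mu(C)^2}{-n}$ (the limit is understood to exist in this setting). Conventions: $M_n(\underline x)=+\infty$ if there is no maximal $k$, and $2/0=+\infty$. *)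

(* Defs.v *)
From HB Require Import structures.
From mathcomp Require Import all_boot all_order all_algebra.
From mathcomp Require Import all_classical all_reals all_analysis.

Set Implicit Arguments.
Unset Strict Implicit.
Unset Printing Implicit Defensive.

Import Order.TTheory GRing.Theory Num.Theory.
Import numFieldNormedType.Exports.

Local Open Scope classical_set_scope.
Local Open Scope ring_scope.

Record markov_shift (I : countType) (A : rel I) := MarkovShift {
  coord :> nat -> I ;
  coordP : forall i, A (coord i) (coord i.+1)
}.

HB.instance Definition _ (I : countType) (A : rel I) :=
  gen_eqMixin (markov_shift A).
HB.instance Definition _ (I : countType) (A : rel I) :=
  gen_choiceMixin (markov_shift A).

Definition shift (I : countType) (A : rel I) (x : markov_shift A) :
    markov_shift A :=
  MarkovShift (fun i => coordP x i.+1).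

Definition cylinder (I : countType) (A : rel I) (k : nat)
    (x : markov_shift A) : set (markov_shift A) :=
  [set y | forall i, (i < k)%N -> y i = x i].

Definition cylinders (I : countType) (A : rel I) (k : nat) :
    set (set (markov_shift A)) :=
  range (cylinder k).

Definition symbol_cylinder (I : countType) (A : rel I) (a : I) :
    set (markov_shift A) :=
  [set y | y 0%N = a].

Definition topologically_mixing (I : countType) (A : rel I) : Prop :=
  forall a b : I, exists n0 : nat, forall n : nat, (n0 < n)%N ->
    (@symbol_cylinder I A a
       `&` iter n (@shift I A) @^-1` @symbol_cylinder I A b)
      !=set0.

Definition locally_holder (R : realType) (I : countType) (A : rel I)
    (phi : markov_shift A -> R) : Prop :=
  exists M zeta : R, [/\ 0 < M, 0 < zeta < 1 &
    forall k : nat, (1 <= k)%N -> forall x y : markov_shift A,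
      (forall i, (i <= k.-1)%N -> x i = y i) ->
      `|phi x - phi y| <= M * zeta ^+ k].

Definition birkhoff_sum (R : realType) (I : countType) (A : rel I)
    (phi : markov_shift A -> R) (m : nat) (x : markov_shift A) : R :=
  \sum_(i < m) phi (iter i (@shift I A) x).

(* [measurableType] requires a distinguished point, so the measurable space is
   indexed by a proof that the shift space is nonempty.  The point chosen plays
   no role in the sigma-algebra. *)
Definition pointed_shift (I : countType) (A : rel I)
    (ne : [set: markov_shift A] !=set0) : Type :=
  markov_shift A.

HB.instance Definition _ (I : countType) (A : rel I)
    (ne : [set: markov_shift A] !=set0) :=
  Choice.copy (pointed_shift ne) (markov_shift A).
HB.instance Definition _ (I : countType) (A : rel I)
    (ne : [set: markov_shift A] !=set0) :=
  isPointed.Build (pointed_shift ne) (sval (cid ne)).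

Definition all_cylinders (I : countType) (A : rel I)
    (ne : [set: markov_shift A] !=set0) : set (set (pointed_shift ne)) :=
  \bigcup_k @cylinders I A k.

Notation shift_space ne := (g_sigma_algebraType (@all_cylinders _ _ ne)).

Definition shift_invariant (R : realType) (I : countType) (A : rel I)
    (ne : [set: markov_shift A] !=set0)
    (mu : probability (shift_space ne) R) : Prop :=
  forall B : set (shift_space ne), measurable B ->
    mu (@shift I A @^-1` B) = mu B.

Definition gibbs_measure (R : realType) (I : countType) (A : rel I)
    (ne : [set: markov_shift A] !=set0)
    (phi : markov_shift A -> R) (mu : probability (shift_space ne) R) : Prop :=
  shift_invariant mu /\
  exists c P : R, 0 < c /\ forall (m : nat) (x : markov_shift A),
    ((c^-1)%:E
       <= mu (cylinder m x) / (expR (- (m%:R * P) + birkhoff_sum phi m x))%:E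
       <= c%:E)%E.

Definition renyi_entropy (R : realType) (I : countType) (A : rel I)
    (ne : [set: markov_shift A] !=set0)
    (mu : probability (shift_space ne) R) : \bar R :=
  limn (fun n : nat =>
    (lne (\esum_(C in @cylinders I A n) (mu C ^+ 2)) / (- n%:R)%:E)%E).

Definition repeat_lengths (I : countType) (A : rel I) (n : nat)
    (x : markov_shift A) : set nat :=
  [set k | exists i j : nat, (i < j <= n.-1)%N /\
     forall l : nat, (l < k)%N -> x (i + l)%N = x (j + l)%N].

(* The greatest repeat length, and +oo when there is none. *)
Definition longest_repeat (R : realType) (I : countType) (A : rel I) (n : nat)
    (x : markov_shift A) : \bar R :=
  let K : set (\bar R) := [set (k%:R)%:E | k in repeat_lengths n x] in
  xget +oo%E (K `&` ubound K).

(* Main.v *)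
Require Import Defs.
From HB Require Import structures.
From mathcomp Require Import all_boot all_order all_algebra.
From mathcomp Require Import all_classical all_reals all_analysis.
From mathcomp Require Import ring lra zify.

Set Implicit Arguments.
Unset Strict Implicit.
Unset Printing Implicit Defensive.

Import Order.TTheory GRing.Theory Num.Theory.
Import numFieldNormedType.Exports.

Local Open Scope classical_set_scope.
Local Open Scope ring_scope.

(** The Gibbs bounds compare the mass of a word with the exponential of a
Birkhoff sum, and Birkhoff sums are additive along an orbit. So the mass of
words is quasi-multiplicative (gibbs_quasi_bernoulli): up to a constant factor
K, the mass of an admissible concatenation is the product of the masses. This
gives upper bounds by products for disjoint windows (m_meet_le). A lower bound
needs admissible connections. The successors of every symbol have total mass at
least 1/K, and so do its predecessors, hence both meet a fixed finite set of
symbols; mixing on that finite set then joins any two admissible words by one of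
finitely many words of a fixed length g, and windows at distance at least g are
independent from below up to a factor kappa (m_meet_ge).

Let z k be the sum of the squares of the masses of the words of length k. It is
submultiplicative up to a constant, so - ln (z k) / k converges to the Rényi
entropy H by Fekete's lemma. The limit is finite because at every length some
word has a mass that decays at most exponentially (z_lower), and positive as
soon as there are two symbols because then all masses decay exponentially
(entropy_exists, p_decay). With one symbol the unique path repeats forever and
both sides are +oo.

Upper bound. A repeat of length k at distance at least k has mass at most K^2 z
k, and an overlapping one at most K sqrt (z k). There are N^2 pairs of positions
of the first kind below N but only N k of the second kind, so the mass of a
repeat within e^(k tau) letters is exponentially small when tau < H / 2
(m_repeats, ae_no_repeats).

Lower bound. The mass of a typical word is smaller than what dominates z k, so
one first selects a mass level q0 such that the words of mass at least q0 have a
total mass q with q0 q nearly as large as z k (heavy_level). Read T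
well-separated blocks: about q T of them are heavy (few_seen). If no block has
been repeated, these are that many different words of mass at least q0, and each
of T further blocks hits one of them with probability of order q0 (q T). Since
q0 q T^2 is exponentially large when T is of the order of e^(k tau) with tau > H
/ 2, the absence of a repeat is exponentially unlikely (m_norepeats_exp,
ae_repeats).

The Borel-Cantelli lemma turns both estimates into almost sure statements for
all large k, and reading them at k close to ln n / tau, with tau tending to H /
2, gives the limit (longest_repeat_cvg). *)

(** * Words and cylinders of a Markov shift *)

Section paths.
Variables (I : countType) (A : rel I).
Implicit Types (x y : markov_shift A) (u v w : seq I).

Definition word (k : nat) x : seq I := mkseq x k.
Definition cyl w : set (markov_shift A) := [set x | word (size w) x = w].
Definition sh (t : nat) x := iter t (@Defs.shift I A) x.
(** Events of the finite stage of the natural filtration. Stating measurability and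
locality with this predicate avoids naming the generating cylinders. *)
Definition depends_on_first (a : nat) (E : set (markov_shift A)) : Prop :=
  forall x y, word a x = word a y -> E x -> E y.

Lemma shE t x i : sh t x i = x (t + i)%N.
Proof. by elim: t i => //= t IH i; rewrite IH addnS. Qed.

Lemma shD s t x : sh s (sh t x) = sh (s + t) x.
Proof. by rewrite /sh iterD. Qed.

Lemma size_word k x : size (word k x) = k.
Proof. exact: size_mkseq. Qed.

Lemma wordP k x y : word k x = word k y <-> forall i, (i < k)%N -> x i = y i.
Proof.
split=> [e i ik|e].
  by have := congr1 (fun s => nth (x 0%N) s i) e; rewrite !nth_mkseq.
by apply/eq_in_map => i; rewrite mem_iota => /= ik; exact: e.
Qed.

Lemma wordD a b x : word (a + b) x = word a x ++ word b (sh a x).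
Proof.
rewrite /word /mkseq iotaD map_cat; congr cat.
rewrite add0n -[a in iota a]addn0 iotaDl -map_comp.
by apply: eq_map => i /=; rewrite shE.
Qed.

Lemma word_take a k x : (a <= k)%N -> take a (word k x) = word a x.
Proof. by move=> ak; rewrite -(subnKC ak) wordD take_size_cat ?size_word. Qed.

Lemma word_le a k x y : (a <= k)%N -> word k x = word k y -> word a x = word a y.
Proof. by move=> ak e; rewrite -(word_take x ak) e word_take. Qed.

Lemma word_sh_eq k t x y : word (t + k) x = word (t + k) y ->
  word k (sh t x) = word k (sh t y).
Proof.
by move/wordP => e; apply/wordP => i ik; rewrite !shE e// ltn_add2l.
Qed.

Lemma cylP w x : cyl w x <-> word (size w) x = w. Proof. by []. Qed.

Lemma cyl_word k x : cyl (word k x) = [set y | word k y = word k x].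
Proof. by rewrite /cyl size_word. Qed.

Lemma mem_cyl_word k x : cyl (word k x) x.
Proof. by rewrite cyl_word. Qed.

Lemma cyl_cat u v : cyl (u ++ v) = cyl u `&` sh (size u) @^-1` cyl v.
Proof.
apply/seteqP; split => x; rewrite /cyl /= size_cat wordD.
  by move/eqP; rewrite eqseq_cat ?size_word// => /andP[/eqP ? /eqP].
by move=> [-> ->].
Qed.

Lemma cyl_catl u v : cyl (u ++ v) `<=` cyl u.
Proof. by rewrite cyl_cat; exact: subIsetl. Qed.

Lemma cyl_catr u v : cyl (u ++ v) !=set0 -> cyl v !=set0.
Proof. by rewrite cyl_cat => -[x [_ h]]; exists (sh (size u) x). Qed.

Lemma cylinderE k x : cylinder k x = cyl (word k x).
Proof.
rewrite cyl_word; apply/seteqP; split => y /=; first by move=> h; apply/wordP.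
by move/wordP.
Qed.

Lemma dep_cyl w : depends_on_first (size w) (cyl w).
Proof. by move=> x y; rewrite /cyl /= => ->. Qed.

Lemma dep_sh t k E :
  depends_on_first k E -> depends_on_first (t + k) (sh t @^-1` E).
Proof. by move=> h x y /word_sh_eq e; exact: h. Qed.

Lemma cyl1 a x : cyl [:: a] x <-> x 0%N = a.
Proof.
by split => [|xa]; [case|apply: (congr1 (fun b => [:: b]))].
Qed.

Lemma glue n x y : x n = y 0%N ->
  exists z : markov_shift A,
    (forall i, (i <= n)%N -> z i = x i) /\ (forall i, z (n + i)%N = y i).
Proof.
move=> xy; pose f i := if (i <= n)%N then x i else y (i - n)%N.
have fA i : A (f i) (f i.+1).
  rewrite /f; case: (ltngtP i n) => [_|ni|->]; first exact: coordP.
    by rewrite subSn ?(ltnW ni)//; exact: coordP.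
  by rewrite subSnn xy; exact: coordP.
exists (MarkovShift fA); split=> i; rewrite /= /f; first by move=> ->.
by case: leqP => h; [have -> : i = 0%N by lia|]; rewrite ?addn0 ?addKn.
Qed.

Lemma cyl_glue u a v : cyl (rcons u a) !=set0 -> cyl (a :: v) !=set0 ->
  cyl (u ++ a :: v) !=set0.
Proof.
move=> -[x]; rewrite -cats1 cyl_cat => -[/= ux xa] [y ya].
have xa' : x (size u) = a by move: xa => /cyl1; rewrite shE addn0.
have ya' : y 0%N = a by move: ya; case.
have [z [z1 z2]] := @glue (size u) x y (etrans xa' (esym ya')).
exists z; rewrite cyl_cat; split.
  apply/cylP; move/cylP: ux => <-; rewrite size_word.
  by apply/wordP => i iu; rewrite z1// ltnW.
apply/cylP; move/cylP: ya => <-; rewrite size_word.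
by apply/wordP => i _; rewrite shE z2.
Qed.

End paths.

(** * Masses of events determined by finitely many letters *)

Lemma esumZl (R : realType) (T : choiceType) (P : set T) (a : T -> \bar R) (r : R) :
  (0 < r)%R -> (forall i, 0 <= a i)%E ->
  (\esum_(i in P) (r%:E * a i) = r%:E * \esum_(i in P) a i)%E.
Proof.
move=> r0 a0; rewrite /esum -ereal_sup_pZl//; congr ereal_sup.
rewrite [RHS](image_comp (fun X => \sum_(x \in X) a x)%E).
by apply: eq_imagel => X _ /=; rewrite ge0_mule_fsumr.
Qed.

Section events.
Variables (R : realType) (I : countType) (A : rel I).
Variables (ne : [set: markov_shift A] !=set0).
Variable mu : probability (shift_space ne) R.
Implicit Types (x y : markov_shift A) (u v w : seq I).
Implicit Types (E F G H : set (markov_shift A)).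

Lemma measurable_cyl w : measurable (cyl w : set (shift_space ne)).
Proof.
have [[x wx]|n0] := pselect (cyl (A := A) w !=set0); last first.
  suff -> : cyl (A := A) w = set0 by exact: measurable0.
  by apply/seteqP; split => // x wx; case: n0; exists x.
apply: sub_sigma_algebra; exists (size w) => //; exists x => //.
by rewrite cylinderE; move/cylP: wx => ->.
Qed.

(** Words are countably many, so such an event is a countable union of cylinders. *)
Lemma measurable_dep k E : depends_on_first k E ->
  measurable (E : set (shift_space ne)).
Proof.
move=> dE.
have -> : E = \bigcup_(w : seq I) [set x | E x /\ word k x = w].
  apply/seteqP; split => x; first by move=> Ex; exists (word k x).
  by case=> w _ [].
apply: countable_bigcupT_measurable; first exact: countableP.
move=> w; have [[x [Ex xw]]|n0] := pselect (exists x, E x /\ word k x = w).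
  suff -> : [set x | E x /\ word k x = w] = cyl w by exact: measurable_cyl.
  rewrite -xw cyl_word; apply/seteqP; split=> y /=; first by case.
  by move=> e; split => //; apply: dE Ex.
suff -> : [set x | E x /\ word k x = w] = set0 by exact: measurable0.
by apply/seteqP; split => // x xw; case: n0; exists x.
Qed.

Lemma measurable_sh_cyl t w :
  measurable (sh t @^-1` cyl w : set (shift_space ne)).
Proof. by apply: measurable_dep; apply: dep_sh; exact: dep_cyl. Qed.

(** Real-valued versions of the measure: all the estimates below are about finite
masses, where ordinary arithmetic is available. *)
Definition mass E : R := fine (mu E).
Definition word_mass w : R := mass (cyl w).
Local Notation m := mass.
Local Notation p := word_mass.

Lemma muE E : measurable (E : set (shift_space ne)) -> mu E = (m E)%:E.
Proof. by move=> mE; rewrite /m fineK// fin_num_measure. Qed.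

Lemma m_ge0 E : 0 <= m E. Proof. exact: fine_ge0. Qed.

Lemma p_ge0 w : 0 <= p w. Proof. exact: m_ge0. Qed.

Lemma mT : m setT = 1. Proof. by rewrite /m probability_setT. Qed.

Lemma m0 : m set0 = 0. Proof. by rewrite /m measure0. Qed.

Lemma m_sub E F : measurable (E : set (shift_space ne)) ->
  measurable (F : set (shift_space ne)) -> E `<=` F -> m E <= m F.
Proof. by move=> mE mF EF; rewrite -lee_fin -!muE// le_measure ?inE. Qed.

Lemma m_le1 E : measurable (E : set (shift_space ne)) -> m E <= 1.
Proof. by move=> mE; rewrite -mT; apply: m_sub. Qed.

Lemma mU E F : measurable (E : set (shift_space ne)) ->
  measurable (F : set (shift_space ne)) -> m (E `|` F) <= m E + m F.
Proof.
move=> mE mF; rewrite -lee_fin EFinD -!muE//; last exact: measurableU.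
exact: measureU2.
Qed.

Lemma m_split E F : measurable (E : set (shift_space ne)) ->
  measurable (F : set (shift_space ne)) -> m E = m (E `&` F) + m (E `&` ~` F).
Proof.
move=> mE mF; apply: EFin_inj; rewrite EFinD -!muE//.
- by rewrite -setDE; rewrite addeC; exact: measureDI.
- by apply: measurableI => //; exact: measurableC.
- exact: measurableI.
Qed.

Definition words k : set (seq I) := [set w | size w = k].

(** Countable additivity over the partition of the space according to the word
read in the window [t, t + k). *)
Lemma mu_words G t k : measurable (G : set (shift_space ne)) ->
  mu G = \esum_(w in words k) mu (G `&` sh t @^-1` cyl w).
Proof.
move=> mG.
pose B w := (G `&` sh t @^-1` cyl w) : set (shift_space ne).
have mB w : measurable (B w).
  by apply: measurableI => //; apply: measurable_dep; apply: dep_sh; exact: dep_cyl.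
pose F n := if pickle_inv n is Some w then
  (if size w == k then B w else set0) else set0.
have FE : G = \bigcup_n F n.
  apply/seteqP; split => [x Gx|x [n _]]; last first.
    by rewrite /F; case: pickle_inv => // w; case: ifP => // _ [].
  exists (pickle (word k (sh t x))) => //; rewrite /F pickleK_inv size_word eqxx.
  by split => //; exact: mem_cyl_word.
have mF n : measurable (F n).
  by rewrite /F; case: pickle_inv => // w; case: ifP.
have tF : trivIset setT F.
  apply/trivIsetP => i j _ _ ij; apply/seteqP; split => // x [].
  rewrite /F; case ui : (pickle_inv i) => [u|//].
  case uj : (pickle_inv j) => [v|//].
  case: eqP => // su; case: eqP => // sv [_ /cylP xu] [_ /cylP xv].
  move/eqP: ij; apply; have uv : u = v by rewrite -xu -xv su sv.
  have := @pickle_invK (seq I) i; have := @pickle_invK (seq I) j.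
  by rewrite ui uj /= uv => <- <-.
rewrite {1}FE measure_semi_bigcup//; last by rewrite -FE.
rewrite nneseries_esumT//.
have -> : \esum_(i in [set: nat]) mu (F i) =
    \esum_(i in pickle @` words k) mu (F i).
  rewrite [RHS]esum_mkcond; apply: eq_esum => i _; case: ifPn => // /negP ni.
  rewrite /F; case ui : (pickle_inv i) => [u|]; last exact: measure0.
  case: eqP => su; last exact: measure0.
  exfalso; apply: ni; rewrite inE; exists u => //.
  by have := @pickle_invK (seq I) i; rewrite ui.
rewrite esum_image; last first.
  move=> u v _ _ uv; have := @pickleK_inv (seq I) v.
  by rewrite -uv pickleK_inv => -[].
by apply: eq_esum => w wk; rewrite /F pickleK_inv wk eqxx.
Qed.

(** The passage from words to events: both sides are summed over the word read in a
window, and the two windows may be at different places. *)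
Lemma m_le_words r1 r2 G H t1 t2 k : 0 < r1 -> 0 < r2 ->
  measurable (G : set (shift_space ne)) -> measurable (H : set (shift_space ne)) ->
  (forall w, size w = k ->
    r1 * m (G `&` sh t1 @^-1` cyl w) <= r2 * m (H `&` sh t2 @^-1` cyl w)) ->
  r1 * m G <= r2 * m H.
Proof.
move=> r10 r20 mG mH le.
have mS B t w : measurable (B : set (shift_space ne)) ->
    measurable ((B `&` sh t @^-1` cyl w) : set (shift_space ne)).
  by move=> mB; apply: measurableI => //; exact: measurable_sh_cyl.
rewrite -lee_fin !EFinM -!muE// (mu_words t1 k mG) (mu_words t2 k mH).
rewrite -!esumZl//; apply: le_esum => w wk.
by rewrite !muE; [rewrite -!EFinM lee_fin; exact: le|exact: mS|exact: mS].
Qed.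

End events.

(** * Quasi-multiplicativity of a Gibbs measure *)

Section quasi_bernoulli.
Variables (R : realType) (I : countType) (A : rel I).
Variables (ne : [set: markov_shift A] !=set0).
Variable mu : probability (shift_space ne) R.
Implicit Types (x y : markov_shift A) (u v w : seq I).
Implicit Types (E F G H : set (markov_shift A)).
Local Notation p := (word_mass mu).
Local Notation m := (mass mu).

(** The lower bound can hold only for admissible concatenations; the upper bound is
trivial for the others. *)
Definition quasi_bernoulli (K : R) : Prop :=
  [/\ 1 <= K, forall w, cyl (A := A) w !=set0 -> 0 < p w,
      forall u v, p (u ++ v) <= K * (p u * p v) &
      forall u v, cyl (A := A) (u ++ v) !=set0 -> p u * p v <= K * p (u ++ v)].

Lemma p_empty w : ~ (cyl (A := A) w !=set0) -> p w = 0.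
Proof.
move=> n0; rewrite /p (_ : cyl w = set0) ?m0//.
by apply/seteqP; split => // x wx; case: n0; exists x.
Qed.

(** Birkhoff sums are additive, and the Gibbs bounds for a word and for its two
halves can be taken along the orbit of the same point. *)
Lemma gibbs_quasi_bernoulli (phi : markov_shift A -> R) :
  gibbs_measure phi mu -> exists K, quasi_bernoulli K.
Proof.
move=> [_ [c [P [c0 gb]]]].
pose e k x := expR (- (k%:R * P) + birkhoff_sum phi k x).
have e0 k x : 0 < e k x by exact: expR_gt0.
have lo k x : e k x <= c * p (word k x).
  have := (andP (gb k x)).1; rewrite cylinderE muE; last exact: measurable_cyl.
  by rewrite inver gt_eqF ?e0// -EFinM lee_fin ler_pdivlMr ?expR_gt0// ler_pdivrMl.
have hi k x : p (word k x) <= c * e k x.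
  have := (andP (gb k x)).2; rewrite cylinderE muE; last exact: measurable_cyl.
  by rewrite inver gt_eqF ?e0// -EFinM lee_fin ler_pdivrMr ?expR_gt0.
have eD a b x : e (a + b)%N x = e a x * e b (sh a x).
  rewrite /e -expRD; congr expR.
  have -> : birkhoff_sum phi (a + b) x =
      birkhoff_sum phi a x + birkhoff_sum phi b (sh a x).
    rewrite /birkhoff_sum big_split_ord /=; congr (_ + _).
    by apply: eq_bigr => i _; congr phi; rewrite [RHS]shD addnC.
  by rewrite natrD mulrDl; ring.
have [x0 _] := ne.
have c1 : 1 <= c.
  have := lo 0%N x0; rewrite /p (_ : cyl _ = setT); last by apply/seteqP; split.
  rewrite mT mulr1; apply: le_trans.
  by rewrite /e /birkhoff_sum big_ord0 mul0r oppr0 addr0 expR0.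
have p0 w : cyl (A := A) w !=set0 -> 0 < p w.
  move=> [x /cylP wx]; have := lo (size w) x; rewrite wx => h.
  by rewrite -(pmulr_rgt0 _ c0); apply: lt_le_trans h.
(* Each of the three Gibbs bounds that are compared costs one factor c. *)
exists (c * (c * c)); split => //.
- by rewrite -[1]mulr1 ler_pM// -[1]mulr1 ler_pM.
- move=> u v; have [n0|n0] := pselect (cyl (A := A) (u ++ v) !=set0); last first.
    by rewrite p_empty// !mulr_ge0 ?p_ge0// ltW.
  case: n0 => x /cylP wx.
  have := hi (size (u ++ v)) x; rewrite wx => /le_trans; apply.
  rewrite size_cat eD -mulrA ler_pM2l// mulrACA ler_pM ?(ltW (e0 _ _))//.
    have := lo (size u) x.
    by rewrite -(word_take x (leq_addr (size v) _)) -size_cat wx take_size_cat.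
  have := lo (size v) (sh (size u) x).
  have /cylP : cyl v (sh (size u) x).
    by have : cyl (u ++ v) x by []; rewrite cyl_cat => -[].
  by move=> ->.
- move=> u v [x wx].
  have := lo (size (u ++ v)) x; move/cylP: (wx) => -> h.
  have -> : c * (c * c) * p (u ++ v) = c * c * (c * p (u ++ v)) by ring.
  apply: (@le_trans _ _ (c * c * e (size (u ++ v)) x)); last first.
    by rewrite ler_pM2l// mulr_gt0.
  rewrite size_cat eD mulrACA; move: wx; rewrite cyl_cat => -[/cylP ux /cylP vx].
  apply: ler_pM; rewrite ?p_ge0//.
    by have := hi (size u) x; rewrite ux.
  by have := hi (size v) (sh (size u) x); rewrite vx.
Qed.

Hypothesis inv : shift_invariant mu.

Lemma m_sh t k E : depends_on_first k E -> m (sh t @^-1` E) = m E.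
Proof.
elim: t k E => // t IH k E dE.
have -> : sh t.+1 @^-1` E = sh t @^-1` (sh 1 @^-1` E) by [].
rewrite (IH _ _ (dep_sh dE)) /m.
by rewrite -[in RHS]inv//; exact: measurable_dep dE.
Qed.

Variable K : R.
Hypothesis qb : quasi_bernoulli K.

Let K1 : 1 <= K. Proof. by case: qb. Qed.
Let K0 : 0 < K. Proof. exact: lt_le_trans K1. Qed.
Let p_gt0 w : cyl (A := A) w !=set0 -> 0 < p w. Proof. by case: qb => _ + _ _; apply. Qed.
Let p_cat u v : p (u ++ v) <= K * (p u * p v).
Proof. by case: qb => _ _ + _; apply. Qed.
Let cat_p u v : cyl (A := A) (u ++ v) !=set0 -> p u * p v <= K * p (u ++ v).
Proof. by case: qb => _ _ _; apply. Qed.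

(** Summation over the word between the two windows reduces the claim to three
adjacent words. *)
Lemma m_meet_le u v t : (size u <= t)%N ->
  m (cyl u `&` sh t @^-1` cyl v) <= K ^+ 2 * (p u * p v).
Proof.
move=> ut; pose E := cyl u `&` sh t @^-1` cyl (A := A) v.
have mE : measurable (E : set (shift_space ne)).
  apply: measurableI; first exact: measurable_cyl.
  apply: measurable_dep; apply: dep_sh; exact: dep_cyl.
have [n0|n0] := pselect (cyl (A := A) u !=set0 /\ cyl (A := A) v !=set0); last first.
  have E0 : E = set0.
    apply/seteqP; split => // x [ux vx]; case: n0.
    by split; [exists x|exists (sh t x)].
  by rewrite -/E E0 m0 !mulr_ge0 ?p_ge0 ?exprn_ge0// ltW.
case: n0 => /p_gt0 pu /p_gt0 pv.
rewrite -[leRHS]mulr1 -(mT mu) -[leLHS]mul1r.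
apply: (m_le_words (t1 := size u) (t2 := 0) (k := t - size u)) => //.
  by rewrite !mulr_gt0 ?exprn_gt0.
move=> w wk; rewrite mul1r setTI.
apply: (@le_trans _ _ (p (u ++ w ++ v))).
  rewrite le_eqVlt; apply/orP; left; apply/eqP; congr (m _).
  rewrite !cyl_cat preimage_setI /E -!setIA; congr (_ `&` _).
  rewrite setIC; congr (_ `&` _); rewrite -{1}(subnK ut) wk.
  by apply/seteqP; split => x /=; rewrite shD.
apply: (le_trans (p_cat _ _)).
rewrite expr2 -!mulrA ler_pM2l//.
have := p_cat w v; move: (p_ge0 mu w) => ? h.
apply: (@le_trans _ _ (p u * (K * (p w * p v)))); first by rewrite ler_pM2l.
by rewrite le_eqVlt -/(p w); apply/orP; left; apply/eqP; ring.
Qed.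

End quasi_bernoulli.

(** * Connecting words and independence from below *)

Lemma list_threshold (T : eqType) (s : seq T) (Q : T -> nat -> Prop) :
  (forall b, b \in s -> exists N, forall n, (N < n)%N -> Q b n) ->
  exists N, forall b, b \in s -> forall n, (N < n)%N -> Q b n.
Proof.
elim: s => [_|a s IH h]; first by exists 0%N.
have [N hN] := IH (fun b bs => h b (mem_behead (s := a :: s) bs)).
have [M hM] := h a (mem_head _ _).
exists (maxn N M) => b; rewrite inE => /orP[/eqP ->|bs] n;
  rewrite gtn_max => /andP[nN nM].
  exact: hM.
exact: hN.
Qed.

Section connecting_words.
Variables (R : realType) (I : countType) (A : rel I).
Variables (ne : [set: markov_shift A] !=set0).
Variable mu : probability (shift_space ne) R.
Implicit Types (x y : markov_shift A) (u v w : seq I).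
Implicit Types (E F G H : set (markov_shift A)).
Local Notation p := (word_mass mu).
Local Notation m := (mass mu).

Lemma dep_symbol (s : seq I) :
  depends_on_first 1 [set x : markov_shift A | x 0%N \notin s].
Proof. by move=> x y; rewrite /word /= => -[->]. Qed.

Lemma measurable_symbol (s : seq I) :
  measurable ([set x : markov_shift A | x 0%N \notin s] : set (shift_space ne)).
Proof. by apply: measurable_dep; exact: dep_symbol. Qed.

(** Tightness: the events that the first symbol has index at least n decrease to the
empty set. *)
Lemma few_symbols (e : R) : 0 < e -> exists s : seq I, m [set x | x 0%N \notin s] < e.
Proof.
move=> e0; pose F n := [set x : shift_space ne | (n <= pickle (x 0%N))%N].
have dF n : depends_on_first 1 (F n).
  by move=> x y; rewrite /F /word /= => -[->].
have mF n : measurable (F n) by exact: measurable_dep (dF n).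
have F0 : \bigcap_n F n = set0.
  apply/seteqP; split => // x h.
  by have := h (pickle (x 0%N)).+1 Logic.I; rewrite /F /= ltnn.
have : mu \o F @ \oo --> mu (\bigcap_n F n).
  apply: nonincreasing_cvg_mu => //; first by rewrite -ge0_fin_numE// fin_num_measure.
    by rewrite F0.
  move=> i j ij; apply/subsetPset => x; rewrite /F /=; exact: leq_trans.
rewrite F0 measure0 => /fine_cvgP[_].
move=> /cvgrPdist_lt /(_ _ e0)[n _ /(_ n (leqnn n))] /=.
rewrite sub0r normrN ger0_norm ?fine_ge0// => h.
exists (pmap pickle_inv (iota 0 n)); apply: le_lt_trans h.
apply: m_sub => //; first exact: measurable_symbol.
move=> x /= xs; rewrite /F /= leqNgt; apply/negP => h; move/negP: xs; apply.
rewrite mem_pmap; apply/mapP; exists (pickle (x 0%N)); last by rewrite pickleK_inv.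
by rewrite mem_iota.
Qed.

Hypothesis mixing : topologically_mixing A.
Hypothesis inv : shift_invariant mu.
Variable K : R.
Hypothesis qb : quasi_bernoulli mu K.

Let K1 : 1 <= K. Proof. by case: qb. Qed.
Let K0 : 0 < K. Proof. exact: lt_le_trans K1. Qed.
Let p_gt0 w : cyl (A := A) w !=set0 -> 0 < p w. Proof. by case: qb => _ + _ _; apply. Qed.
Let p_cat u v : p (u ++ v) <= K * (p u * p v).
Proof. by case: qb => _ _ + _; apply. Qed.
Let cat_p u v : cyl (A := A) (u ++ v) !=set0 -> p u * p v <= K * p (u ++ v).
Proof. by case: qb => _ _ _; apply. Qed.

Lemma cyl1_nonempty a : cyl (A := A) [:: a] !=set0.
Proof.
have [n /(_ n.+1 (ltnSn n))[x [xa _]]] := mixing a a.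
by exists x; apply/cyl1.
Qed.

(** The mass of [a] equals that of the two-letter words [a b], and each of these
is at most K times the product of the masses of [a] and [b]: so the successors
of a carry mass at least 1/K, too much to lie outside s. *)
Lemma successor_in (s : seq I) a : m [set x | x 0%N \notin s] < K^-1 ->
  exists2 b, b \in s & cyl (A := A) [:: a; b] !=set0.
Proof.
move=> hs; apply: contrapT => nb.
pose F := [set x : markov_shift A | x 0%N \notin s].
have pa := p_gt0 (cyl1_nonempty a).
have : 1 * p [:: a] <= (K * p [:: a]) * m F.
  apply: (m_le_words (t1 := 1) (t2 := 0) (k := 1)) => //; first exact: mulr_gt0.
  - exact: measurable_cyl.
  - exact: measurable_symbol.
  case=> [//|b [|//]] _; rewrite mul1r -(cyl_cat A [:: a] [:: b]).
  have [bs|bs] := boolP (b \in s).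
    rewrite -/(p _) p_empty; last by move=> h; apply: nb; exists b.
    by rewrite !mulr_ge0 ?m_ge0 ?p_ge0 ?ltW.
  apply: (le_trans (p_cat [:: a] [:: b])).
  rewrite mulrA ler_pM2l ?mulr_gt0// m_sub//; first exact: measurable_cyl.
    apply: measurableI; first exact: measurable_symbol.
    exact: measurable_cyl.
  by move=> x xb; split => //; move/cyl1: xb => /= xb; rewrite /F /= xb.
rewrite mul1r -mulrA mulrCA -{1}[p _]mulr1 ler_pM2l//.
by apply/negP; rewrite -ltNge mulrC -ltr_pdivlMr// div1r.
Qed.

Lemma predecessor_in (s : seq I) a : m [set x | x 0%N \notin s] < K^-1 ->
  exists2 b, b \in s & cyl (A := A) [:: b; a] !=set0.
Proof.
move=> hs; apply: contrapT => nb.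
pose F := [set x : markov_shift A | x 0%N \notin s].
have pa := p_gt0 (cyl1_nonempty a).
have : 1 * m (sh 1 @^-1` cyl [:: a]) <= (K * p [:: a]) * m F.
  apply: (m_le_words (t1 := 0) (t2 := 0) (k := 1)) => //; first exact: mulr_gt0.
  - exact: measurable_sh_cyl.
  - exact: measurable_symbol.
  case=> [//|b [|//]] _; rewrite mul1r setIC -(cyl_cat A [:: b] [:: a]).
  have [bs|bs] := boolP (b \in s).
    rewrite -/(p _) p_empty; last by move=> h; apply: nb; exists b.
    by rewrite !mulr_ge0 ?m_ge0 ?p_ge0 ?ltW.
  apply: (le_trans (p_cat [:: b] [:: a])).
  rewrite [p [:: b] * _]mulrC mulrA ler_pM2l ?mulr_gt0// m_sub//.
    exact: measurable_cyl.
    apply: measurableI; first exact: measurable_symbol.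
    exact: measurable_cyl.
  by move=> x xb; split => //; move/cyl1: xb => /= xb; rewrite /F /= xb.
rewrite (m_sh inv _ (@dep_cyl _ _ _)) -/(p _).
rewrite mul1r -mulrA mulrCA -{1}[p _]mulr1 ler_pM2l//.
by apply/negP; rewrite -ltNge mulrC -ltr_pdivlMr// div1r.
Qed.

(** Both ends are routed through a finite set s that meets the successors and the
predecessors of every symbol. Mixing is uniform over the pairs in s, which fixes
the length, and the finitely many joining words have masses bounded below. *)
Lemma connecting_word : exists g (eta : R), 0 < eta /\
  forall u v, cyl (A := A) u !=set0 -> cyl (A := A) v !=set0 ->
  exists w, [/\ size w = g, cyl (A := A) (u ++ w ++ v) !=set0 & eta <= p w].
Proof.
have [s hs] : exists s : seq I, m [set x | x 0%N \notin s] < K^-1.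
  by apply: few_symbols; rewrite invr_gt0.
have [N hN] : exists N, forall b, b \in s -> forall n, (N < n)%N ->
    forall c, c \in s -> exists y : markov_shift A, y 0%N = b /\ y n = c.
  apply: list_threshold => b _.
  suff [N hN] : exists N, forall c, c \in s -> forall n, (N < n)%N ->
      exists y : markov_shift A, y 0%N = b /\ y n = c.
    by exists N => n nN c cs; exact: hN.
  apply: list_threshold => c _; have [n0 h] := mixing b c.
  exists n0 => n /h[y [yb yc]].
  by exists y; split => //; rewrite -(addn0 n) -shE.
have /choice[Y hY] : forall bc : I * I, exists y : markov_shift A,
    bc.1 \in s -> bc.2 \in s -> y 0%N = bc.1 /\ y N.+1 = bc.2.
  move=> [b c] /=; have [/andP[bs cs]|n] := boolP ((b \in s) && (c \in s)).
    by have [y hy] := hN b bs N.+1 (ltnSn _) c cs; exists y.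
  by have [y _] := ne; exists y => bs cs; rewrite bs cs in n.
have [M hM] : exists M, forall b, b \in s -> forall n, (M < n)%N ->
    forall c, c \in s -> n%:R^-1 <= p (word N.+2 (Y (b, c))).
  apply: list_threshold => b _.
  suff [M hM] : exists M, forall c, c \in s -> forall n, (M < n)%N ->
      n%:R^-1 <= p (word N.+2 (Y (b, c))).
    by exists M => n nM c cs; exact: hM.
  apply: list_threshold => c _; have pw : 0 < p (word N.+2 (Y (b, c))).
    by apply: p_gt0; exists (Y (b, c)); exact: mem_cyl_word.
  have [n0 hn0] : exists n0, (p (word N.+2 (Y (b, c))))^-1 < n0%:R.
    exists (Num.bound (p (word N.+2 (Y (b, c))))^-1).
    by rewrite archi_boundP// invr_ge0 ltW.
  exists n0 => n nn0; rewrite invf_ple ?posrE// ?ltr0n; last by case: n nn0.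
  by apply: ltW; apply: lt_le_trans hn0 _; rewrite ler_nat ltnW.
exists N.+2, (M.+1%:R^-1); split; first by rewrite invr_gt0.
have [x0 _] := ne; pose a0 := x0 0%N.
have key u a c v :
    cyl (A := A) (rcons u a) !=set0 -> cyl (A := A) (c :: v) !=set0 ->
  exists w, [/\ size w = N.+2,
    cyl (A := A) (rcons u a ++ w ++ c :: v) !=set0 & M.+1%:R^-1 <= p w].
  move=> ua cv; have [b bs ab] := successor_in a hs.
  have [b' bs' bc] := predecessor_in c hs.
  exists (word N.+2 (Y (b, b'))); rewrite size_word; split => //; last exact: hM.
  have [yb yb'] : Y (b, b') 0%N = b /\ Y (b, b') N.+1 = b' := hY (b, b') bs bs'.
  move: (Y _) yb yb' => y yb yb'.
  have e1 : word N.+2 y = b :: word N.+1 (sh 1 y) by rewrite (wordD 1) -yb.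
  have e2 : word N.+2 y = rcons (word N.+1 y) b' by rewrite -yb'; exact: mkseqS.
  have h1 : cyl (A := A) (rcons (rcons u a) b) !=set0.
    by rewrite -!cats1 -catA; exact: (cyl_glue ua ab).
  have h2 : cyl (A := A) (rcons u a ++ word N.+2 y) !=set0.
    by rewrite e1; apply: (cyl_glue h1); rewrite -e1; exists y; exact: mem_cyl_word.
  have h3 : cyl (A := A) ([:: b'] ++ c :: v) !=set0 by apply: cyl_glue.
  by rewrite e2 (cat_rcons b') catA; apply: cyl_glue => //; rewrite rcons_cat -e2.
move=> u v u0 v0.
(* An empty word is first extended by the symbol a0; dropping it afterwards keeps
   the cylinder nonempty. *)
have [u' [a [ua ue]]] : exists u' a, cyl (A := A) (rcons u' a) !=set0 /\
    exists u'', rcons u' a = u'' ++ u.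
  case/lastP: u u0 => [_|u a ua]; last by exists u, a; split => //; exists [::].
  by exists [::], a0; split; [exact: cyl1_nonempty|exists [:: a0]].
have [c [v' [cv ve]]] : exists c v', cyl (A := A) (c :: v') !=set0 /\
    exists v'', c :: v' = v ++ v''.
  case: v v0 => [_|c v cv]; last by exists c, v; split => //; exists [::]; rewrite cats0.
  by exists a0, [::]; split; [exact: cyl1_nonempty|exists [:: a0]].
have [w [sw wne pw]] := key u' a c v' ua cv.
exists w; split => //; move: wne; case: ue => u'' ->; case: ve => v'' ->.
by rewrite -catA => /cyl_catr; rewrite !catA => -[x /cyl_catl]; exists x.
Qed.

(** A connecting word of length g turns the two windows into one admissible word. *)
Lemma m_meet_ge : exists g (kappa : R), 0 < kappa <= 1 /\
  forall u v, kappa * (p u * p v) <= m (cyl u `&` sh (size u + g) @^-1` cyl v).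
Proof.
have [g [eta [eta0 h]]] := connecting_word.
(* The minimum with 1 keeps 1 - kappa q nonnegative for every mass q. *)
exists g, (Num.min 1 (eta / K ^+ 2)); split.
  by rewrite lt_min ltr01 divr_gt0 ?exprn_gt0//= ge_min lexx.
move=> u v.
have [[u0 v0]|n0] :=
  pselect (cyl (A := A) u !=set0 /\ cyl (A := A) v !=set0); last first.
  suff -> : p u * p v = 0 by rewrite mulr0 m_ge0.
  apply/eqP; rewrite mulf_eq0; have [u0|u0] := pselect (cyl (A := A) u !=set0).
    by rewrite (p_empty _ (w := v)) ?eqxx ?orbT// => v0; apply: n0.
  by rewrite p_empty ?eqxx.
have [w [sw wne pw]] := h u v u0 v0.
apply: (@le_trans _ _ (p (u ++ w ++ v))); last first.
  apply: m_sub; first exact: measurable_cyl.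
    apply: measurableI; first exact: measurable_cyl.
    exact: measurable_sh_cyl.
  move=> x; rewrite !cyl_cat => -[? [_ /=]]; rewrite shD sw addnC => ?; split => //.
apply: (@le_trans _ _ (eta / K ^+ 2 * (p u * p v))).
  by rewrite ler_wpM2r ?mulr_ge0 ?p_ge0// ge_min lexx orbT.
rewrite mulrAC ler_pdivrMr ?exprn_gt0//.
have h1 := cat_p wne; have h2 := cat_p (cyl_catr wne).
apply: (@le_trans _ _ (p w * (p u * p v))).
  by rewrite ler_wpM2r ?mulr_ge0 ?p_ge0.
apply: (@le_trans _ _ (K * (p u * p (w ++ v)))).
  by rewrite mulrCA [leRHS]mulrCA ler_wpM2l ?p_ge0.
have -> : p (u ++ w ++ v) * K ^+ 2 = K * (K * p (u ++ w ++ v)) by ring.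
by rewrite ler_pM2l.
Qed.

End connecting_words.

(** * Sums of squared word masses *)

Section power_sums.
Variables (R : realType) (I : countType) (A : rel I).
Variables (ne : [set: markov_shift A] !=set0).
Variable mu : probability (shift_space ne) R.
Implicit Types (x y : markov_shift A) (u v w : seq I).
Implicit Types (E F G H : set (markov_shift A)).
Local Notation p := (word_mass mu).
Local Notation m := (mass mu).

Definition square_sum (k : nat) : R :=
  fine (\esum_(w in words k) ((p w) ^+ 2)%:E).
Local Notation z := square_sum.

Lemma esum_p k : (\esum_(w in words k) (p w)%:E = 1)%E.
Proof.
rewrite -(probability_setT mu) (mu_words mu 0 k)//; apply: eq_esum => w _.
by rewrite setTI muE//; exact: measurable_cyl.
Qed.

Lemma zE k : (\esum_(w in words k) ((p w) ^+ 2)%:E = (z k)%:E)%E.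
Proof.
rewrite /z fineK// ge0_fin_numE; last first.
  by apply: esum_ge0 => w _; rewrite lee_fin exprn_ge0// p_ge0.
apply: (@le_lt_trans _ _ 1%E); last exact: ltry.
rewrite -(esum_p k); apply: le_esum => w _; rewrite lee_fin expr2.
by rewrite ler_piMr ?p_ge0// m_le1//; exact: measurable_cyl.
Qed.

Lemma z_ge0 k : 0 <= z k.
Proof. by apply/fine_ge0/esum_ge0 => w _; rewrite lee_fin exprn_ge0// p_ge0. Qed.

Lemma p_le_z w : (p w) ^+ 2 <= z (size w).
Proof.
rewrite -lee_fin -zE; apply: esum_ge; exists [set w].
  by split; [exact: finite_set1|move=> _ ->].
by rewrite fsbig_set1.
Qed.

(** Crude but sufficient for overlapping repeats, whose number is only linear in the
number of letters, up to a factor k. *)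
Lemma p_le_sqrt w : p w <= Num.sqrt (z (size w)).
Proof. by rewrite -(ger0_norm (p_ge0 mu w)) -sqrtr_sqr ler_wsqrtr// p_le_z. Qed.

(** A bound of each squared mass by a combination of masses inside the cylinder sums
to a bound of z by the same combination of global masses. *)
Lemma z_le_comb k n (c : nat -> R) (G : nat -> set (markov_shift A)) :
  (forall i, 0 < c i) ->
  (forall i, measurable (G i : set (shift_space ne))) ->
  (forall w, size w = k -> p w ^+ 2 <= \sum_(i < n) c i * m (G i `&` cyl w)) ->
  z k <= \sum_(i < n) c i * m (G i).
Proof.
move=> c0 mG h; rewrite -lee_fin -zE -sumEFin.
have mGc i w : measurable ((G i `&` cyl w) : set (shift_space ne)).
  by apply: measurableI => //; exact: measurable_cyl.
apply: (@le_trans _ _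
  (\esum_(w in words k) \sum_(i < n) ((c i)%:E * mu (G i `&` cyl w)))%E).
  apply: le_esum => w wk; under eq_bigr do rewrite muE// -EFinM.
  by rewrite sumEFin lee_fin; exact: h.
rewrite esum_sum; last by move=> w i _ _; rewrite mule_ge0 ?lee_fin ?(ltW (c0 i)).
by apply: lee_sum => i _; rewrite esumZl// EFinM -muE// (mu_words mu 0 k (mG i)).
Qed.

Lemma z_le k s : 0 < s -> (forall w, size w = k -> p w <= s) -> z k <= s.
Proof.
move=> s0 h.
have := @z_le_comb k 1 (fun=> s) (fun=> setT) (fun=> s0)
  (fun=> @measurableT _ (shift_space ne)).
rewrite big_ord1 mT mulr1; apply=> w wk.
by rewrite big_ord1 setTI expr2 ler_wpM2r ?p_ge0// h.
Qed.

Lemma le_z k r G : 0 < r -> measurable (G : set (shift_space ne)) ->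
  (forall w, size w = k -> m (G `&` cyl w) <= r * p w ^+ 2) -> m G <= r * z k.
Proof.
move=> r0 mG h; rewrite -lee_fin EFinM -zE -muE// (mu_words mu 0 k mG).
rewrite -esumZl//; last by move=> w; rewrite lee_fin exprn_ge0// p_ge0.
apply: le_esum => w wk; rewrite muE ?lee_fin//; first exact: h.
by apply: measurableI => //; exact: measurable_cyl.
Qed.

(** The Rényi sums over cylinder sets are the sums over words: empty cylinders
contribute nothing, and distinct words have distinct nonempty cylinders. *)
Lemma esum_cylinders k : \esum_(C in @cylinders I A k) (mu C ^+ 2)%E = (z k)%:E.
Proof.
pose N := [set w | cyl (A := A) w !=set0].
have -> : @cylinders I A k = (@cyl I A) @` (words k `&` N).
  apply/seteqP; split => [_ [x _ <-]|_ [w [wk [x wx]] <-]].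
    exists (word k x); last by rewrite cylinderE.
    by split; [exact: size_word|exists x; exact: mem_cyl_word].
  by exists x => //; rewrite cylinderE; move/cylP: wx => <-; rewrite wk.
rewrite esum_image; last first.
  move=> u v; rewrite !inE => -[uk [x ux]] [vk _] uv.
  have : cyl v x by rewrite -uv.
  by move/cylP => <-; move/cylP: ux => {1}<-; rewrite uk vk.
rewrite esum_mkcondr -zE; apply: eq_esum => w _.
rewrite EFin_expe -muE; last exact: measurable_cyl.
case: ifPn => // /negP wN; rewrite muE; last exact: measurable_cyl.
by rewrite -/(p w) p_empty ?expe2 ?mul0e// => h; apply: wN; rewrite inE.
Qed.

Variable K : R.
Hypothesis qb : quasi_bernoulli mu K.
Let K1 : 1 <= K. Proof. by case: qb. Qed.
Let K0 : 0 < K. Proof. exact: lt_le_trans K1. Qed.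
Let p_cat u v : p (u ++ v) <= K * (p u * p v).
Proof. by case: qb => _ _ + _; apply. Qed.

(** Cutting a word in two, by the upper half of quasi-multiplicativity. *)
Lemma z_submult a b : z (a + b) <= K ^+ 2 * (z a * z b).
Proof.
have zle0 w : (0 <= (p w ^+ 2)%:E :> \bar R)%E by rewrite lee_fin exprn_ge0// p_ge0.
rewrite -lee_fin -zE.
have zb0 : (0 <= (z b)%:E)%E by rewrite lee_fin z_ge0.
rewrite (reindex_esum (words a `*`` (fun=> words b)) _
  (fun uv => uv.1 ++ uv.2)); last first.
  split => [[u v] [/= ua vb]|[u v] [u' v']|w wab] /=.
  - by rewrite /words /= size_cat ua vb.
  - rewrite !inE => -[/= ua vb] [/= ua' vb'] /eqP; rewrite eqseq_cat ?ua ?ua'//.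
    by move=> /andP[/eqP -> /eqP ->].
  - exists (take a w, drop a w); last by rewrite /= cat_take_drop.
    split; rewrite /words /=; first by rewrite size_takel// wab leq_addr.
    by rewrite size_drop wab addKn.
apply: (@le_trans _ _ (\esum_(k in words a `*`` (fun=> words b))
   ((K ^+ 2 * p k.1 ^+ 2)%:E * (p k.2 ^+ 2)%:E))%E).
  apply: le_esum => -[u v] _ /=; rewrite -EFinM lee_fin -mulrA -!exprMn.
  by rewrite lerXn2r ?nnegrE ?p_ge0// !mulr_ge0 ?p_ge0// ltW.
rewrite -(esum_esum
  (a := fun u v => ((K ^+ 2 * p u ^+ 2)%:E * (p v ^+ 2)%:E)%E)); last first.
  by move=> u v _ _; rewrite mule_ge0// lee_fin mulr_ge0 ?exprn_ge0 ?p_ge0// ltW.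
apply: (@le_trans _ _ (\esum_(u in words a) ((K ^+ 2 * z b)%:E * (p u ^+ 2)%:E))%E).
  apply: le_esum => u ua; have [pu|pu] := eqVneq (p u) 0.
    rewrite esum1; first by rewrite pu expr0n /= mule0.
    by move=> v _; rewrite pu expr0n /= mulr0 mul0e.
  rewrite esumZl//; first by rewrite zE -!EFinM lee_fin mulrAC.
  have {}pu : 0 < p u by rewrite lt_neqAle eq_sym pu p_ge0.
  by rewrite mulr_gt0 ?exprn_gt0.
have [zb|zb] := eqVneq (z b) 0.
  by rewrite zb mulr0 esum1 ?mulr0// => u _; rewrite mul0e.
rewrite esumZl//; first by rewrite zE -EFinM lee_fin -mulrA [z b * _]mulrC.
have {}zb : 0 < z b by rewrite lt_neqAle eq_sym zb z_ge0.
by rewrite mulr_gt0 ?exprn_gt0.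
Qed.

End power_sums.

(** * Fekete's lemma and conditional hitting estimates *)

(** If f k / k is nearly minimal, dividing n by k bounds f n by n (f k / k) up to a
constant. *)
Lemma fekete (R : realType) (f : nat -> R) (B : R) :
  (forall a b, f (a + b)%N <= f a + f b) -> (forall n, - B * n%:R <= f n) ->
  exists L, (forall n, (0 < n)%N -> L <= f n / n%:R) /\
    (fun n => f n / n%:R) @ \oo --> L.
Proof.
move=> sub lb.
pose S := [set f n.+1 / n.+1%:R | n in [set: nat]].
have S0 : has_inf S.
  split; first by exists (f 1 / 1), 0%N.
  by exists (- B) => _ [n _ <-]; rewrite ler_pdivlMr ?ltr0n.
have Lle n : (0 < n)%N -> inf S <= f n / n%:R.
  by case: n => // n _; apply: ge_inf; [exact: S0.2|exists n].
exists (inf S); split => //.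
apply/cvgrPdist_le => e e0.
have e20 : 0 < e / 2 by rewrite divr_gt0.
have [_ [k _ <-] hk] := inf_adherent e20 S0.
pose M := \sum_(r < k.+1) `|f r|.
have Mr r : (r < k.+1)%N -> f r <= M.
  move=> rk; rewrite /M (bigD1 (Ordinal rk)) //= (le_trans (ler_norm _))// lerDl.
  by apply: sumr_ge0 => i _; exact: normr_ge0.
have mul q r : f (q * k.+1 + r)%N <= q%:R * f k.+1 + f r.
  elim: q => [|q IH]; first by rewrite mul0n mul0r add0r add0n.
  rewrite mulSn -addnA; apply: (le_trans (sub _ _)).
  by rewrite -natr1 mulrDl mul1r [_ * _ + _]addrC -addrA lerD2l.
pose C := `|f k.+1| + M.
have C0 : 0 <= C by rewrite addr_ge0// sumr_ge0.
have up n : f n <= n%:R * (f k.+1 / k.+1%:R) + C.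
  rewrite {1}(divn_eq n k.+1); apply: (le_trans (mul _ _)).
  rewrite addrA lerD//; last by apply: Mr; rewrite ltn_mod.
  have k0 : (0 : R) < k.+1%:R by rewrite ltr0n.
  have nE : n%:R = (n %/ k.+1)%:R * k.+1%:R + (n %% k.+1)%:R :> R.
    by rewrite -natrM -natrD -divn_eq.
  (* f k.+1 may be negative, so the quotient is replaced by n / k.+1 exactly. *)
  have qE : (n %/ k.+1)%:R * f k.+1 =
      n%:R * (f k.+1 / k.+1%:R) - (n %% k.+1)%:R / k.+1%:R * f k.+1.
    by rewrite nE; field; rewrite gt_eqF.
  rewrite qE lerD2l; apply: (le_trans (ler_norm _)); rewrite normrN normrM.
  rewrite ger0_norm ?divr_ge0// ler_piMl// ler_pdivrMr// mul1r ler_nat ltnW//.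
  by rewrite ltn_mod.
near=> n.
have n0 : (0 < n)%N by near: n; exact: nbhs_infty_gt.
rewrite distrC ger0_norm ?subr_ge0 ?Lle// lerBlDl ler_pdivrMr ?ltr0n//.
apply: (le_trans (up n)).
have : n%:R * (f k.+1 / k.+1%:R) <= n%:R * (inf S + e / 2).
  by rewrite ler_wpM2l// ltW.
have : C <= n%:R * (e / 2).
  rewrite -ler_pdivrMr//; near: n; exact: nbhs_infty_ger.
move=> h1 h2; apply: (le_trans (lerD h2 h1)).
by rewrite -mulrDr -addrA -splitr mulrC.
Unshelve. all: by end_near. Qed.

Section mixing_steps.
Variables (R : realType) (I : countType) (A : rel I).
Variables (ne : [set: markov_shift A] !=set0).
Variable mu : probability (shift_space ne) R.
Implicit Types (x y : markov_shift A) (u v w : seq I).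
Implicit Types (E F G H : set (markov_shift A)).
Local Notation p := (word_mass mu).
Local Notation m := (mass mu).
Variables (g : nat) (kappa : R).
Hypothesis k0 : 0 < kappa.
Hypothesis k1 : kappa <= 1.
Hypothesis meet_ge : forall u v,
  kappa * (p u * p v) <= m (cyl u `&` sh (size u + g) @^-1` cyl v).

(** The target may be any event of a window, by summation over the words in it. *)
Lemma cyl_meet_ge w F k : depends_on_first k F ->
  kappa * p w * m F <= m (cyl w `&` sh (size w + g) @^-1` F).
Proof.
move=> dF; have [->|pw] := eqVneq (p w) 0; first by rewrite mulr0 mul0r m_ge0.
have {}pw : 0 < p w by rewrite lt_neqAle eq_sym pw p_ge0.
rewrite -[leRHS]mul1r.
have mF := measurable_dep (ne := ne) dF.
have mG : measurable (cyl w `&` sh (size w + g) @^-1` F : set (shift_space ne)).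
  apply: measurableI; first exact: measurable_cyl.
  by apply: measurable_dep; exact: dep_sh dF.
apply: (m_le_words (t1 := 0) (t2 := size w + g) (k := k)) => //.
  exact: mulr_gt0.
move=> v vk; have [[x [Fx /cylP xv]]|n0] := pselect (F `&` cyl v !=set0).
  have vF : cyl v `<=` F.
    by move=> y /cylP yv; apply: dF Fx; rewrite -vk xv yv.
  have -> : F `&` sh 0 @^-1` cyl v = cyl v by rewrite setIC; apply/setIidPl.
  rewrite mul1r -setIA (_ : sh _ @^-1` F `&` _ = sh (size w + g) @^-1` cyl v).
    by rewrite -mulrA; exact: meet_ge.
  by apply/seteqP; split => y [] //= ?; split => //; exact: vF.
have -> : F `&` sh 0 @^-1` cyl v = set0.
  by apply/seteqP; split => // x h; case: n0; exists x.
by rewrite m0 mulr0 mul1r m_ge0.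
Qed.

Definition next_in a (F : markov_shift A -> set (markov_shift A)) :=
  [set x | F x (sh (a + g) x)].

Lemma dep_next_in a k (F : markov_shift A -> set (markov_shift A)) :
  (forall x, depends_on_first k (F x)) ->
  (forall x y, word a x = word a y -> F x = F y) ->
  depends_on_first (a + g + k) (next_in a F).
Proof.
move=> dF eF x y e; rewrite /next_in /=.
rewrite (eF x y) => [|]; last first.
  by apply: word_le e; rewrite -addnA leq_addr.
by apply: dF; exact: word_sh_eq.
Qed.

(** Conditionally on the first a letters the target is a fixed event, to which
cyl_meet_ge applies. *)
Lemma step_hit a k E (F : markov_shift A -> set (markov_shift A)) q :
  depends_on_first a E ->
  (forall x, depends_on_first k (F x)) ->
  (forall x y, word a x = word a y -> F x = F y) ->
  (forall x, E x -> q <= m (F x)) ->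
  kappa * q * m E <= m (E `&` next_in a F).
Proof.
move=> dE dF eF qF; have [q0|q0] := leP q 0.
  apply: (le_trans _ (m_ge0 _ _)); apply: mulr_le0_ge0; last exact: m_ge0.
  by rewrite mulr_ge0_le0// ltW.
rewrite -[leRHS]mul1r.
have mE := measurable_dep (ne := ne) dE.
have mG : measurable (E `&` next_in a F : set (shift_space ne)).
  apply: measurableI => //.
  exact: measurable_dep (dep_next_in dF eF).
apply: (m_le_words (t1 := 0) (t2 := 0) (k := a)) => //.
  exact: mulr_gt0.
move=> w wa; have [[x [Ex /cylP xw]]|n0] := pselect (E `&` cyl w !=set0).
  have wE : cyl w `<=` E.
    by move=> y /cylP yw; apply: dE Ex; rewrite -wa xw yw.
  have -> : E `&` sh 0 @^-1` cyl w = cyl w by rewrite setIC; apply/setIidPl.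
  have -> : E `&` next_in a F `&` sh 0 @^-1` cyl w =
      cyl w `&` sh (size w + g) @^-1` F x.
    apply/seteqP; split => y /=.
      move=> [[Ey Fy] wy]; split => //; rewrite /= wa (eF x y)//.
      by rewrite -wa xw; move/cylP: wy.
    move=> [wy Fy]; split => //; split; first exact: wE.
    rewrite /next_in /= -wa -(eF x y)//.
    by rewrite -wa xw; move/cylP: wy.
  rewrite mul1r; apply: le_trans (cyl_meet_ge _ (dF x)).
  rewrite mulrAC ler_wpM2l ?qF//.
  by rewrite mulr_ge0 ?p_ge0// ltW.
have -> : E `&` sh 0 @^-1` cyl w = set0.
  by apply/seteqP; split => // x h; case: n0; exists x.
by rewrite m0 mulr0 mul1r m_ge0.
Qed.

Lemma step_miss a k E (F : markov_shift A -> set (markov_shift A)) q :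
  depends_on_first a E ->
  (forall x, depends_on_first k (F x)) ->
  (forall x y, word a x = word a y -> F x = F y) ->
  (forall x, E x -> q <= m (F x)) ->
  m (E `&` ~` next_in a F) <= (1 - kappa * q) * m E.
Proof.
move=> dE dF eF qF; have := step_hit dE dF eF qF.
rewrite (m_split mu (measurable_dep (ne := ne) dE)
  (measurable_dep (ne := ne) (dep_next_in dF eF))).
move: (m (E `&` next_in a F)) (m (E `&` ~` next_in a F)) => s t; lra.
Qed.

(** A window of g + 1 letters has to avoid one of two symbols at its end, which
costs a fixed factor: cylinders shrink exponentially. *)
Lemma p_decay a b : a != b -> 0 < p [:: a] -> 0 < p [:: b] ->
  exists r, 0 < r < 1 /\ forall j w, (j * g.+1 <= size w)%N -> p w <= r ^+ j.
Proof.
move=> ab pa pb; pose th := Num.min (p [:: a]) (p [:: b]).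
have th0 : 0 < th by rewrite lt_min pa pb.
have th1 : th <= 1.
  by rewrite ge_min (m_le1 mu (@measurable_cyl _ A ne [:: a])).
have kth0 : 0 < kappa * th by exact: mulr_gt0.
have kth1 : kappa * th <= 1 by rewrite -[1]mulr1 ler_pM// ltW.
(* Halving keeps the rate positive even when kappa th = 1. *)
exists (1 - kappa * th / 2); split; first by apply/andP; split; lra.
elim=> [|j IH] w wj; first by rewrite expr0 m_le1//; exact: measurable_cyl.
have [n0|n0] := pselect (cyl (A := A) w !=set0); last first.
  by rewrite p_empty// exprn_ge0//; lra.
pose u := take (size w - g.+1) w; pose d := nth a w (size u + g).
have su : (size u = size w - g.+1)%N by rewrite size_takel// leq_subr.
have sw : (g.+1 <= size w)%N by apply: leq_trans wj; rewrite mulSn leq_addr.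
have suw : (size u + g < size w)%N by rewrite su -addnS subnK.
(* One of the two symbols differs from the last letter d of w. *)
pose c := if d == a then b else a.
have thc : th <= p [:: c] by rewrite /c ge_min; case: ifP; rewrite lexx ?orbT.
have cd : c != d by rewrite /c; case: (eqVneq d a) => [->|]; rewrite 1?eq_sym.
have mF := @measurable_sh_cyl _ A ne (size u + g) [:: c].
have : p u <= p u by []; rewrite {1}/p (m_split mu (@measurable_cyl _ A ne u) mF).
have h1 : kappa * th * p u <= m (cyl u `&` sh (size u + g) @^-1` cyl [:: c]).
  apply: le_trans (meet_ge u [:: c]); rewrite -mulrA ler_pM2l// mulrC.
  by rewrite ler_wpM2l ?p_ge0.
have h2 : p w <= m (cyl u `&` ~` (sh (size u + g) @^-1` cyl [:: c])).
  apply: m_sub; first exact: measurable_cyl.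
    by apply: measurableI; [exact: measurable_cyl|exact: measurableC].
  move=> x wx; split.
    by move: wx; rewrite -(cat_take_drop (size w - g.+1) w) => /cyl_catl.
  move=> /cyl1; rewrite shE addn0 => xc; move/negP: cd; apply.
  by rewrite -xc /d; move/cylP: wx => <-; rewrite nth_mkseq.
have h3 : p u <= (1 - kappa * th / 2) ^+ j.
  by apply: IH; rewrite su leq_subRL// -mulSn.
move: h1 h2; rewrite -/(p u); move: (m _) (m _) => s t h1 h2 h4.
have pw0 := p_ge0 mu u; rewrite exprS.
apply: (@le_trans _ _ ((1 - kappa * th / 2) * p u)); last first.
  by rewrite ler_wpM2l//; lra.
move: h1 h2 h4 pw0; rewrite -/(p w); move: (p w) (p u) => pw pu h1 h2 h4 pu0.
have : 0 <= kappa * th * pu by rewrite mulr_ge0// ltW.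
have -> : (1 - kappa * th / 2) * pu = pu - kappa * th * pu / 2 by ring.
move: h1; move: (kappa * th * pu) => T *; lra.
Qed.
End mixing_steps.

(** * The Rényi entropy *)

Section entropy.
Variables (R : realType) (I : countType) (A : rel I).
Variables (ne : [set: markov_shift A] !=set0).
Variable mu : probability (shift_space ne) R.
Implicit Types (x y : markov_shift A) (u v w : seq I).
Local Notation p := (word_mass mu).
Local Notation m := (mass mu).
Local Notation z := (square_sum mu).
Hypothesis mixing : topologically_mixing A.
Hypothesis inv : shift_invariant mu.
Variable K : R.
Hypothesis qb : quasi_bernoulli mu K.

Let K1 : 1 <= K. Proof. by case: qb. Qed.
Let K0 : 0 < K. Proof. exact: lt_le_trans K1. Qed.
Let p_gt0 w : cyl (A := A) w !=set0 -> 0 < p w. Proof. by case: qb => _ + _ _; apply. Qed.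
Let cat_p u v : cyl (A := A) (u ++ v) !=set0 -> p u * p v <= K * p (u ++ v).
Proof. by case: qb => _ _ _; apply. Qed.

(** Returning to a fixed symbol along the connecting words yields, at every
length, one word whose mass is not smaller than exponential. *)
Lemma z_lower : exists rho, 0 < rho /\ forall n, rho ^+ n <= z n.
Proof.
have [g [eta [eta0 h]]] := connecting_word mixing inv qb.
have [x0 _] := ne; pose a := x0 0%N.
have a_ne := cyl1_nonempty mixing a; have pa := p_gt0 a_ne.
pose c := eta * p [:: a] / K ^+ 2.
have c0 : 0 < c by rewrite divr_gt0 ?mulr_gt0 ?exprn_gt0.
have words_u n : exists u, [/\ (n <= size u)%N, cyl (A := A) u !=set0 & c ^+ n <= p u].
  elim: n => [|n [u [nu u0 cu]]].
    exists [::]; split => //; first by exists x0.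
    by rewrite expr0 /p (_ : cyl _ = setT) ?mT//; apply/seteqP; split.
  have [w [wg wne pw]] := h u [:: a] u0 a_ne.
  exists (u ++ w ++ [:: a]); split => //.
    by rewrite !size_cat addnA addn1 ltnS (leq_trans nu)// leq_addr.
  have h1 := cat_p wne; have h2 := cat_p (cyl_catr wne).
  rewrite exprS /c -(ler_pM2l (exprn_gt0 2 K0)).
  have -> : K ^+ 2 * (eta * p [:: a] / K ^+ 2 * c ^+ n) = c ^+ n * (eta * p [:: a]).
    by field; rewrite gt_eqF.
  have -> : K ^+ 2 * p (u ++ w ++ [:: a]) = K * (K * p (u ++ w ++ [:: a])) by ring.
  apply: (@le_trans _ _ (K * (p u * p (w ++ [:: a])))); last by rewrite ler_pM2l.
  rewrite [leRHS]mulrCA; apply: ler_pM => //; first by rewrite exprn_ge0// ltW.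
    by rewrite mulr_ge0// ltW.
  by apply: le_trans h2; rewrite ler_pM2r.
exists (c ^+ 2); split; first exact: exprn_gt0.
move=> n; have [u [nu u0 cu]] := words_u n.
have sn : size (take n u) = n by rewrite size_takel.
apply: (@le_trans _ _ (p (take n u) ^+ 2)); last first.
  by have := p_le_z mu (take n u); rewrite sn.
rewrite -exprM mulnC exprM lerXn2r ?nnegrE ?p_ge0 ?(ltW (exprn_gt0 _ c0))//.
apply: (le_trans cu); apply: m_sub; do ?exact: measurable_cyl.
by rewrite -{1}(cat_take_drop n u); exact: cyl_catl.
Qed.

Lemma z_gt0 n : 0 < z n.
Proof. by have [r [r0 h]] := z_lower; apply: lt_le_trans (h n); exact: exprn_gt0. Qed.

(** Fekete's lemma applies to ln (K^2 z n), for which z_submult is exact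
subadditivity. Its limit is an infimum, so one length with z n < K^-2 is enough
for positivity, and exponential decay of masses provides it. *)
Lemma entropy_exists : exists H : R,
  [/\ (forall a b : I, a != b -> 0 < H), 
      (fun n => - ln (z n) / n%:R) @ \oo --> H & renyi_entropy mu = H%:E].
Proof.
have [rho [rho0 hrho]] := z_lower.
pose f n := ln (K ^+ 2 * z n).
have K20 : 0 < K ^+ 2 by exact: exprn_gt0.
have fE n : f n = ln (K ^+ 2) + ln (z n) by rewrite /f lnM ?posrE// z_gt0.
have [|n|L [Linf fL]] := @fekete R f (- ln rho).
- move=> a b; rewrite -lnM ?posrE ?mulr_gt0 ?z_gt0//.
  rewrite ler_ln ?posrE ?mulr_gt0 ?z_gt0//.
  by rewrite mulrACA -[leRHS]mulrA ler_pM2l// z_submult.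
- rewrite opprK fE mulrC -[leLHS]add0r lerD ?ln_ge0 ?exprn_ege1//.
  by rewrite mulr_natl -lnXn// ler_ln ?posrE ?exprn_gt0 ?z_gt0.
have zH : (fun n => - ln (z n) / n%:R) @ \oo --> - L.
  have -> : (fun n => - ln (z n) / n%:R) =
      (fun n => ln (K ^+ 2) * n%:R^-1 - f n / n%:R).
    by apply/funext => n; rewrite fE; ring.
  rewrite -[- L]add0r; apply: cvgB => //.
  rewrite -[X in _ --> X](mulr0 (ln (K ^+ 2))); apply: cvgMr.
  apply/gtr0_cvgV0; last exact: cvgr_idn.
  by near=> n; rewrite ltr0n; near: n; exact: nbhs_infty_gt.
exists (- L); split => //.
  move=> a b ab.
  have [g [kappa [/andP[k0 k1] meet]]] := m_meet_ge mixing inv qb.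
  have [r [/andP[r0 r1] hr]] := p_decay k0 k1 meet ab (p_gt0 (cyl1_nonempty mixing a))
    (p_gt0 (cyl1_nonempty mixing b)).
  have [j jK] : exists j, r ^+ j < (K ^+ 2)^-1.
    have : (fun j => r ^+ j) @ \oo --> 0 by apply: cvg_expr; rewrite ger0_norm ?ltW.
    have e0 : 0 < (K ^+ 2)^-1 by rewrite invr_gt0.
    move=> /cvgrPdist_lt /(_ _ e0)[j _ /(_ j (leqnn j))] /=.
    by rewrite sub0r normrN ger0_norm ?exprn_ge0 ?ltW// => ?; exists j.
  have j0 : (0 < j)%N.
    case: j jK => //; rewrite expr0 => h; exfalso; move: h; apply/negP.
    by rewrite -leNgt invf_le1// exprn_ege1.
  have n0 : (0 < j * g.+1)%N by rewrite muln_gt0 j0.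
  rewrite oppr_gt0; apply: le_lt_trans (Linf _ n0) _.
  rewrite ltr_pdivrMr ?ltr0n// mul0r ln_lt0// mulr_gt0 ?z_gt0//=.
  rewrite -ltr_pdivlMl// mulr1; apply: le_lt_trans jK.
  by apply: z_le => [|w wn]; [exact: exprn_gt0|apply: hr; rewrite wn].
apply/cvg_lim => //.
have : (fun n => (- ln (z n) / n%:R)%:E) @ \oo --> (- L)%:E.
  by apply: cvg_EFin => //; exact: nearW.
apply: cvg_trans; apply: near_eq_cvg; near=> n.
have n0 : (0 < n)%N by near: n; exact: nbhs_infty_gt.
rewrite esum_cylinders lne_EFin ?z_gt0// inver oppr_eq0 gt_eqF ?ltr0n//.
by rewrite -EFinM invrN mulrN mulNr.
Unshelve. all: by end_near. Qed.

End entropy.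

(** * Repeats are rare below the critical length scale *)

Section repeats_upper.
Variables (R : realType) (I : countType) (A : rel I).
Variables (ne : [set: markov_shift A] !=set0).
Variable mu : probability (shift_space ne) R.
Implicit Types (x y : markov_shift A) (u v w : seq I).
Implicit Types (E F G H : set (markov_shift A)).
Local Notation p := (word_mass mu).
Local Notation m := (mass mu).
Local Notation z := (square_sum mu).

Lemma m_union N (E : nat -> set (markov_shift A)) :
  (forall i, measurable (E i : set (shift_space ne))) ->
  measurable ([set x | exists2 i, (i < N)%N & E i x] : set (shift_space ne)) /\
  m [set x | exists2 i, (i < N)%N & E i x] <= \sum_(i < N) m (E i).
Proof.
move=> mE; elim: N => [|N [mN IH]].
  rewrite (_ : [set x | _] = set0) ?big_ord0 ?m0//.
  by apply/seteqP; split => // x [].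
have -> : [set x | exists2 i, (i < N.+1)%N & E i x] =
    [set x | exists2 i, (i < N)%N & E i x] `|` E N.
  apply/seteqP; split => x.
    move=> [i]; rewrite ltnS leq_eqVlt => /orP[/eqP ->|iN] Ei; first by right.
    by left; exists i.
  by move=> [[i iN Ei]|EN]; [exists i => //; rewrite ltnW|exists N].
split; first exact: measurableU.
by rewrite big_ord_recr /=; apply: (le_trans (mU mu mN (mE N))); rewrite lerD2r.
Qed.

Lemma borel_cantelli_exp (E : nat -> set (markov_shift A)) (C d : R) k0 :
  (forall k, measurable (E k : set (shift_space ne))) -> 0 < C -> 0 < d ->
  (forall k, (k0 <= k)%N -> m (E k) <= C * expR (- (k%:R * d))) ->
  {ae mu, forall x : shift_space ne, \forall k \near \oo, ~ E k x}.
Proof.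
move=> mE C0 d0 h; pose F k : set (shift_space ne) := E (k + k0)%N.
pose r := expR (- d).
have r0 : 0 < r by exact: expR_gt0.
have r1 : r < 1 by rewrite /r -expR0 ltr_expR oppr_lt0.
have hF k : m (F k) <= C * r ^+ k.
  apply: (le_trans (h _ (leq_addl _ _))); rewrite ler_pM2l// /r -expRM_natl ler_expR.
  by rewrite natrD mulrN lerN2 ler_pM2r// lerDl.
have sF : (\sum_(k <oo) mu (F k) < +oo)%E.
  apply: (@le_lt_trans _ _ (C / (1 - r))%:E); last exact: ltry.
  apply: lime_le; first by apply: is_cvg_nneseries => *; exact: measure_ge0.
  near=> n; apply: (@le_trans _ _ (\sum_(0 <= k < n) (C * r ^+ k)%:E)%E).
    by apply: lee_sum => k _; rewrite muE ?lee_fin ?hF//; exact: mE.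
  rewrite sumEFin lee_fin -mulr_sumr ler_pM2l//.
  have -> : \sum_(0 <= i < n) r ^+ i = (1 - r ^+ n) / (1 - r).
    have := @geometric_seriesE _ 1 r (negbT (lt_eqF r1)) => /(congr1 (@^~ n)).
    rewrite /series /geometric /= mul1r => <-.
    by apply: eq_bigr => i _; rewrite mul1r.
  rewrite ler_pdivrMr ?subr_gt0// mulVf ?gt_eqF ?subr_gt0//.
  by rewrite lerBlDr lerDl exprn_ge0// ltW.
exists (lim_sup_set F); split.
- apply: bigcap_measurable => // n _.
  by apply: bigcup_measurable => k _; exact: mE.
- by apply: lim_sup_set_cvg0 => // k; exact: mE.
- move=> x nx n _; apply: contrapT => nn; apply: nx.
  exists (n + k0)%N => // k /= nk Ek; apply: nn; exists (k - k0)%N => /=; first by lia.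
  by rewrite /F subnK//; lia.
Unshelve. all: by end_near. Qed.

Hypothesis mixing : topologically_mixing A.
Hypothesis inv : shift_invariant mu.
Variable K : R.
Hypothesis qb : quasi_bernoulli mu K.
Let K1 : 1 <= K. Proof. by case: qb. Qed.
Let K0 : 0 < K. Proof. exact: lt_le_trans K1. Qed.
Let p_cat u v : p (u ++ v) <= K * (p u * p v).
Proof. by case: qb => _ _ + _; apply. Qed.

Definition repeat_at k i j : set (markov_shift A) :=
  [set x | word k (sh i x) = word k (sh j x)].

Definition repeats k N : set (markov_shift A) :=
  [set x | exists i j, (i < j < N)%N /\ repeat_at k i j x].

Lemma dep_repeat_at k i j : (i <= j)%N -> depends_on_first (j + k) (repeat_at k i j).
Proof.
move=> ij x y e; rewrite /repeat_at /=.
have -> : word k (sh j x) = word k (sh j y) by exact: word_sh_eq.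
suff -> : word k (sh i x) = word k (sh i y) by [].
by apply: word_sh_eq; apply: word_le e; rewrite leq_add2r.
Qed.

Lemma measurable_repeat_at k i j : (i <= j)%N ->
  measurable (repeat_at k i j : set (shift_space ne)).
Proof. by move=> ij; apply: measurable_dep; exact: dep_repeat_at. Qed.

(** Both windows carry the same word w, so the mass is at most the sum over w of
K^2 times the square of its mass. *)
Lemma m_rep_far k d : (k <= d)%N -> m (repeat_at k 0 d) <= K ^+ 2 * z k.
Proof.
move=> kd; apply: le_z => //; first exact: exprn_gt0.
  exact: measurable_repeat_at.
move=> w wk; have -> : repeat_at k 0 d `&` cyl w = cyl w `&` sh d @^-1` cyl w.
  rewrite /repeat_at /cyl wk; apply/seteqP; split => x /=.
    by move=> [e wx]; split => //; rewrite -e.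
  by move=> [wx e]; split => //; rewrite e.
by rewrite expr2; apply: m_meet_le => //; rewrite wk.
Qed.

(** A self-overlapping repeat at distance d determines the whole word from its
first d letters. *)
Lemma m_rep_near k d : (0 < d)%N -> m (repeat_at k 0 d) <= K * Num.sqrt (z k).
Proof.
move=> d0; have s0 : 0 < Num.sqrt (z k) by rewrite sqrtr_gt0 (z_gt0 mixing inv qb).
rewrite -[leRHS]mulr1 -(mT mu) -[leLHS]mul1r.
apply: (m_le_words (t1 := 0) (t2 := 0) (k := d)) => //.
- exact: mulr_gt0.
- exact: measurable_repeat_at.
move=> w wd; rewrite mul1r setTI.
have [[x [Gx /cylP wx]]|n0] := pselect (repeat_at k 0 d `&` cyl w !=set0); last first.
  rewrite (_ : _ `&` _ = set0); first by rewrite m0 !mulr_ge0 ?m_ge0 ?ltW.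
  by apply/seteqP; split => // x h; case: n0; exists x.
apply: (@le_trans _ _ (p (w ++ word k (sh d x)))); last first.
  apply: (le_trans (p_cat _ _)); rewrite -mulrA ler_pM2l// mulrC ler_wpM2r ?m_ge0//.
  by have := p_le_sqrt mu (word k (sh d x)); rewrite size_word.
apply: m_sub.
- by apply: measurableI; [exact: measurable_repeat_at|exact: (@measurable_sh_cyl _ _ ne 0)].
- exact: measurable_cyl.
move=> y [Gy wy]; have {}wy : word (size w) y = w by [].
rewrite -wx wd -wordD cyl_word /=; apply/wordP.
have first i : (i < d)%N -> y i = x i.
  by move: i; apply/wordP; rewrite -wd wy wx.
elim/ltn_ind => i IH ik; have [/first//|di] := ltnP i d.
move/wordP: Gx => /(_ (i - d)%N); move/wordP: Gy => /(_ (i - d)%N).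
rewrite !shE !add0n subnKC// => Gy Gx; rewrite -Gx -?Gy; [|lia..].
by apply: IH; lia.
Qed.

(** Union bound over the start i and the distance d + 1: all distances pay the
quadratic price z k, and only the k shortest ones pay the price of an overlap. *)
Lemma m_repeats k N : measurable (repeats k N : set (shift_space ne)) /\
  m (repeats k N) <= N%:R ^+ 2 * (K ^+ 2 * z k) +
    N%:R * (k%:R * (K * Num.sqrt (z k))).
Proof.
have mR i d : measurable (repeat_at k i (i + d.+1) : set (shift_space ne)).
  by apply: measurable_repeat_at; rewrite leq_addr.
have mR' i d : measurable ((if (i + d.+1 < N)%N
    then repeat_at k i (i + d.+1) else set0) : set (shift_space ne)).
  by case: ifP.
have repE : repeats k N = [set x | exists2 i, (i < N)%N & exists2 d, (d < N)%N &
    (if (i + d.+1 < N)%N then repeat_at k i (i + d.+1) else set0) x].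
  apply/seteqP; split => x.
    move=> [i [j [/andP[ij jN] r]]]; exists i; first exact: ltn_trans jN.
    exists (j - i.+1)%N; first lia.
    have -> : (i + (j - i.+1).+1)%N = j by lia.
    by rewrite jN.
  move=> [i iN [d dN]]; case: ifP => // dN' r.
  by exists i, (i + d.+1)%N; split => //; rewrite dN' addnS ltnS leq_addr.
have mm i := @m_union N _ (mR' i).
have [mU hU] := @m_union N _ (fun i => (mm i).1).
rewrite repE; split => //; apply: (le_trans hU).
have one i : m [set x | exists2 d, (d < N)%N &
    (if (i + d.+1 < N)%N then repeat_at k i (i + d.+1) else set0) x] <=
    N%:R * (K ^+ 2 * z k) + k%:R * (K * Num.sqrt (z k)).
  apply: (le_trans (mm i).2).
  apply: (@le_trans _ _ (\sum_(d < N)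
      (K ^+ 2 * z k + (d < k)%N%:R * (K * Num.sqrt (z k))))).
    apply: ler_sum => d _; have z0 := z_ge0 mu k.
    have s0 : 0 <= Num.sqrt (z k) by exact: sqrtr_ge0.
    have a0 : 0 <= K ^+ 2 * z k by rewrite mulr_ge0// exprn_ge0// ltW.
    have b0 : 0 <= K * Num.sqrt (z k) by rewrite mulr_ge0// ltW.
    case: ifP => _; last by rewrite m0 addr_ge0// mulr_ge0.
    have -> : m (repeat_at k i (i + d.+1)) = m (repeat_at k 0 d.+1).
      rewrite -(m_sh inv i (dep_repeat_at (k := k) (leq0n d.+1))); congr (m _).
      have e x : sh d.+1 (sh i x) = sh (i + d.+1) x by rewrite shD addnC.
      apply/seteqP; split => x h.
        exact: etrans h (congr1 (word k) (esym (e x))).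
      exact: etrans h (congr1 (word k) (e x)).
    case: ltnP => dk; first by rewrite mul1r ler_wpDl//; exact: m_rep_near.
    by rewrite mul0r addr0; apply: m_rep_far; exact: leq_trans (leqnSn _).
  rewrite big_split /= sumr_const card_ord mulr_natl lerD2l -mulr_suml.
  rewrite ler_wpM2r ?mulr_ge0 ?sqrtr_ge0 ?(ltW K0)//.
  rewrite -natr_sum ler_nat.
  suff : (\sum_(d < N) (d < k) <= minn N k)%N by rewrite leq_min => /andP[].
  elim: (N) => [|n IH]; first by rewrite big_ord0.
  move: IH; rewrite big_ord_recr /= !leq_min => /andP[h1 h2].
  rewrite -[in leqRHS]addn1 leq_add ?leq_b1//=.
  by case: ltnP => nk; rewrite ?addn0// addn1; exact: leq_ltn_trans h1 nk.
apply: (@le_trans _ _ (\sum_(i < N)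
    (N%:R * (K ^+ 2 * z k) + k%:R * (K * Num.sqrt (z k))))).
  by apply: ler_sum => i _; exact: one.
by rewrite sumr_const card_ord -[leLHS]mulr_natl mulrDr mulrA -expr2.
Qed.

End repeats_upper.

(** * Repeats are likely above the critical length scale *)

Section repeats_lower.
Variables (R : realType) (I : countType) (A : rel I).
Variables (ne : [set: markov_shift A] !=set0).
Variable mu : probability (shift_space ne) R.
Implicit Types (x y : markov_shift A) (u v w : seq I).
Implicit Types (E F G H : set (markov_shift A)).
Local Notation p := (word_mass mu).
Local Notation m := (mass mu).
Local Notation z := (square_sum mu).

Definition heavy k (q0 : R) : set (markov_shift A) := [set x | q0 <= p (word k x)].

Lemma dep_heavy k q0 : depends_on_first k (heavy k q0).
Proof. by move=> x y; rewrite /heavy /= => ->. Qed.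

Lemma measurable_heavy k q0 : measurable (heavy k q0 : set (shift_space ne)).
Proof. by apply: measurable_dep; exact: dep_heavy. Qed.

Lemma heavy_cyl k q0 w : size w = k ->
  m (heavy k q0 `&` cyl w) = (q0 <= p w)%R%:R * p w.
Proof.
move=> wk; case: (boolP (q0 <= p w)) => qw /=.
  rewrite mul1r; congr (m _); apply/setIidPr => x /cylP xw.
  by rewrite /heavy /= -wk xw.
rewrite mul0r -(m0 mu); congr (m _); apply/seteqP; split => // x [/= + /cylP xw].
by rewrite /heavy /= -wk xw (negPf qw).
Qed.

(** Discretised layer-cake formula for the sum of squares. *)
Lemma z_layers k L : z k <=
  \sum_(l < L) expR (- l%:R) * m (heavy k (expR (- l.+1%:R))) + expR (- L%:R).
Proof.
pose G l := if (l < L)%N then heavy k (expR (- l.+1%:R)) else setT.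
have num (t : R) n : 0 <= t <= 1 ->
    t <= \sum_(l < n) expR (- l%:R) * (expR (- l.+1%:R) <= t)%R%:R + expR (- n%:R).
  move=> /andP[t0 t1]; elim: n => [|n IH].
    by rewrite big_ord0 add0r oppr0 expR0.
  have e0 l : 0 < expR (- l%:R) :> R by exact: expR_gt0.
  rewrite big_ord_recr /=; case: (leP (expR (- n.+1%:R)) t) => h /=.
    by rewrite mulr1; apply: (le_trans IH); rewrite lerDl ltW.
  rewrite mulr0 addr0; apply: (le_trans (ltW h)); rewrite lerDr.
  by apply: sumr_ge0 => i _; rewrite mulr_ge0 ?ler0n// ltW.
have GL : G L = setT by rewrite /G ltnn.
have Gl (l : 'I_L) : G l = heavy k (expR (- l.+1%:R)) by rewrite /G ltn_ord.
have := @z_le_comb _ _ _ _ mu k L.+1 (fun l => expR (- l%:R)) G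
  (fun l => expR_gt0 _).
rewrite big_ord_recr /= GL mT mulr1.
under eq_bigr => l _ do rewrite Gl.
apply=> [l|w wk].
  rewrite /G; case: ifP => _; first exact: measurable_heavy.
  exact: (@measurableT _ (shift_space ne)).
rewrite big_ord_recr /= GL setTI -/(p w).
under eq_bigr => l _ do rewrite Gl heavy_cyl// mulrA.
rewrite -mulr_suml -mulrDl expr2 ler_wpM2r ?p_ge0// num// p_ge0/=.
by apply: m_le1; exact: measurable_cyl.
Qed.

(** One of the L layers contributes at least the average; the remainder e^-L is at
most half of z k. *)
Lemma heavy_level k L : (0 < L)%N -> 2 * expR (- L%:R) <= z k ->
  exists q0, 0 < q0 /\ z k / (2 * expR 1 * L%:R) <= q0 * m (heavy k q0).
Proof.
move=> L0 zL; apply: contrapT => h.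
have eL : 0 < expR 1 :> R by exact: expR_gt0.
have L0' : 0 < L%:R :> R by rewrite ltr0n.
have hl (l : nat) : expR (- l%:R) * m (heavy k (expR (- l.+1%:R))) < z k / (2 * L%:R).
  rewrite ltNge; apply/negP => h1; apply: h; exists (expR (- l.+1%:R)).
  split; first exact: expR_gt0.
  move: h1; have -> : expR (- l%:R) = expR 1 * expR (- l.+1%:R) :> R.
    by rewrite -expRD; congr expR; rewrite -natr1; ring.
  rewrite -mulrA -ler_pdivrMl// => h1; apply: le_trans h1.
  by rewrite le_eqVlt; apply/orP; left; apply/eqP; field; rewrite !gt_eqF.
have : \sum_(l < L) expR (- l%:R) * m (heavy k (expR (- l.+1%:R))) < z k / 2.
  have -> : z k / 2 = \sum_(l < L) (z k / (2 * L%:R)).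
    by rewrite sumr_const card_ord -mulr_natl; field; rewrite gt_eqF.
  apply: ltr_sum => [|l _]; last exact: hl.
  by apply/hasP; exists (Ordinal L0); rewrite // mem_index_enum.
have := z_layers k L; lra.
Qed.

Lemma m_words_ge k q0 (ws : seq (seq I)) : uniq ws ->
  (forall w, w \in ws -> size w = k /\ q0 <= p w) ->
  q0 * (size ws)%:R <= m [set y | word k y \in ws].
Proof.
elim: ws => [_ _|w ws IH /= /andP[wws uws] h].
  by rewrite mulr0 m_ge0.
have d (s : seq (seq I)) :
    depends_on_first k [set y : markov_shift A | word k y \in s].
  by move=> x y /= ->.
have [wk qw] := h w (mem_head _ _).
have {}IH := IH uws (fun v vs => h v (mem_behead (s := w :: ws) vs)).
rewrite (m_split mu (F := cyl w) (measurable_dep (ne := ne) (d (w :: ws)))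
  (measurable_cyl _)).
rewrite -natr1 mulrDr mulr1 addrC; apply: lerD.
  rewrite (_ : _ `&` cyl w = cyl w)//; apply/setIidPr => x /cylP.
  by rewrite /= wk => ->; rewrite mem_head.
apply: (le_trans IH); apply: m_sub; first exact: measurable_dep (d ws).
  apply: measurableI; first exact: measurable_dep (d (w :: ws)).
  by apply: measurableC; exact: measurable_cyl.
move=> x /= xws; split; first by rewrite inE xws orbT.
by move=> /cylP; rewrite wk => xw; move: wws; rewrite -xw xws.
Qed.

Variables (g : nat) (kappa : R).
Hypothesis kappa0 : 0 < kappa.
Hypothesis kappa1 : kappa <= 1.
Hypothesis meet_ge : forall u v,
  kappa * (p u * p v) <= m (cyl u `&` sh (size u + g) @^-1` cyl v).

Section blocks.
Variable k : nat.
(** Consecutive blocks are separated by g letters, the length of the connecting words;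
the first T blocks are read within T (k + g) letters. *)
Definition block i x : seq I := word k (sh (i * (k + g) + g) x).
Definition blocks T x : seq (seq I) := mkseq (fun i => block i x) T.
Definition seen q0 T x : seq (seq I) := [seq w <- blocks T x | q0 <= p w].

Lemma word_blocks T x y : word (T * (k + g)) x = word (T * (k + g)) y ->
  blocks T x = blocks T y.
Proof.
move=> e; apply/eq_in_map => i; rewrite mem_iota => /= iT.
apply: word_sh_eq; apply: word_le e.
apply: (@leq_trans (i.+1 * (k + g))).
  by rewrite mulSn -addnA [(g + k)%N]addnC addnC.
by rewrite leq_mul2r iT orbT.
Qed.

Lemma word_seen q0 T x y : word (T * (k + g)) x = word (T * (k + g)) y ->
  seen q0 T x = seen q0 T y.
Proof. by move=> /word_blocks e; rewrite /seen e. Qed.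

Lemma seenS q0 T x : seen q0 T.+1 x =
  if q0 <= p (block T x) then rcons (seen q0 T x) (block T x) else seen q0 T x.
Proof. by rewrite /seen /blocks mkseqS filter_rcons. Qed.

Lemma measurable_few q0 T r :
  measurable ([set x | (size (seen q0 T x) < r)%N] : set (shift_space ne)).
Proof.
apply: (@measurable_dep _ _ _ (T * (k + g))).
by move=> x y /word_seen /= ->.
Qed.

(** Large deviation bound for the number of heavy blocks, by induction on the
number of blocks: a new block is heavy with conditional probability at least
kappa q. *)
Lemma few_seen q0 T r :
  m [set x | (size (seen q0 T x) < r)%N] <=
  2 ^+ r * (1 - kappa * m (heavy k q0) / 2) ^+ T.
Proof.
set q := m (heavy k q0).
have q_ge0 : 0 <= q by exact: m_ge0.
have q_le1 : q <= 1 by apply: m_le1; exact: measurable_heavy.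
have kq1 : kappa * q <= 1 by rewrite -[1]mulr1 ler_pM// ltW.
have kq0 : 0 <= kappa * q by rewrite mulr_ge0// ltW.
elim: T r => [|T IH] r.
  rewrite expr0 mulr1; apply: (@le_trans _ _ 1); last by rewrite exprn_ege1// ler1n.
  by apply: m_le1; exact: measurable_few.
case: r => [|r].
  rewrite (_ : [set x | _] = set0) ?m0 ?mulr_ge0 ?exprn_ge0//; first by lra.
  by apply/seteqP; split.
pose less n := [set x | (size (seen q0 T x) < n)%N].
have mless n : measurable (less n : set (shift_space ne)).
  exact: measurable_few.
pose E := less r.+1 `&` ~` less r.
have mE : measurable (E : set (shift_space ne)).
  by apply: measurableI => //; exact: measurableC.
have dE : depends_on_first (T * (k + g)) E.
  by move=> x y /word_seen e; rewrite /E /less /= -e.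
pose F (x : markov_shift A) := heavy k q0.
have dF x : depends_on_first k (F x) by exact: dep_heavy.
have miss := step_miss kappa0 meet_ge dE dF (fun _ _ _ => erefl)
  (q := q) (fun _ _ => lexx _).
have dN := dep_next_in (g := g) (a := T * (k + g)) dF (fun _ _ _ => erefl).
have cover : m [set x | (size (seen q0 T.+1 x) < r.+1)%N] <=
    m (less r) + m (E `&` ~` next_in g (T * (k + g)) F).
  have mN : measurable (E `&` ~` next_in g (T * (k + g)) F : set (shift_space ne)).
    by apply: measurableI => //; apply: measurableC; exact: measurable_dep dN.
  apply: le_trans (mU mu (mless r) mN); apply: m_sub; last 1 first.
  - move=> x /=; rewrite seenS; case: ifPn => h; rewrite ?size_rcons ltnS => h1.
      by left.
    have [|h2] := ltnP (size (seen q0 T x)) r; first by left.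
    right; split.
      by split; rewrite /less /= ?ltnS//; apply/negP; rewrite -leqNgt.
    by rewrite /next_in /F /heavy /=; apply/negP.
  - exact: measurable_few.
  - exact: measurableU.
apply: (le_trans cover); apply: (le_trans (lerD (lexx _) miss)).
have sp := m_split mu (mless r.+1) (mless r).
have lr : less r.+1 `&` less r = less r.
  by apply/setIidPr => x; rewrite /less /= => h; exact: leq_trans h (leqnSn _).
rewrite lr -/E in sp.
have -> : m E = m (less r.+1) - m (less r) by rewrite sp; ring.
have := IH r; have := IH r.+1; rewrite -/(less _) -/(less _).
set a := m _; set b := m _ => ha hb.
rewrite [(1 - _) ^+ T.+1]exprS; move: ha hb; rewrite exprS; set c := _ ^+ T.
(* Pascal-type recursion: kappa q f(r) + (1 - kappa q) f(r + 1), where f(r + 1) is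
   bounded by twice the bound of f(r). *)
set d := 2 ^+ r => ha hb.
have -> : 2 * d * ((1 - kappa * q / 2) * c) =
  kappa * q * (d * c) + (1 - kappa * q) * (2 * d * c) by field.
have -> : b + (1 - kappa * q) * (a - b) =
  kappa * q * b + (1 - kappa * q) * a by ring.
by rewrite lerD// ler_wpM2l// subr_ge0.
Qed.

(** As long as no block is repeated, the heavy words seen in the first T blocks are
distinct, so together they have mass at least q0 r; a later block among them
would be a repeat, which has conditional probability at least kappa q0 r. *)
Lemma no_later_repeat q0 T r j : 0 <= q0 ->
  m [set x | uniq (blocks (T + j) x) /\ (r <= size (seen q0 T x))%N] <=
  expR (- (j%:R * (kappa * (q0 * r%:R)))).
Proof.
move=> q0_ge0; pose E j :=
  [set x | uniq (blocks (T + j) x) /\ (r <= size (seen q0 T x))%N].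
have seenE n x : seen q0 T x = [seq w <- take T (blocks (T + n) x) | q0 <= p w].
  by rewrite /seen /blocks /mkseq iotaD map_cat take_size_cat// size_map size_iota.
have wT n x y : word ((T + n) * (k + g)) x = word ((T + n) * (k + g)) y ->
    seen q0 T x = seen q0 T y.
  by move=> /word_blocks e; rewrite (seenE n) e -seenE.
have dE n : depends_on_first ((T + n) * (k + g)) (E n).
  move=> x y e; have e1 := word_blocks e; have e2 := wT n x y e.
  by rewrite /E /= -e1 -e2.
have mE n : measurable (E n : set (shift_space ne)) by exact: measurable_dep (dE n).
rewrite -/(E j); elim: j => [|j IH].
  by rewrite mul0r oppr0 expR0; exact: m_le1.
pose F x := [set y : markov_shift A | word k y \in seen q0 T x].
have dF x : depends_on_first k (F x) by move=> y y'; rewrite /F /= => ->.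
have eF x y : word ((T + j) * (k + g)) x = word ((T + j) * (k + g)) y -> F x = F y.
  by move=> /(wT j) e; rewrite /F e.
have miss := step_miss kappa0 meet_ge (dE j) dF eF (q := q0 * r%:R) _.
have dN := dep_next_in (g := g) dF eF.
apply: (@le_trans _ _ ((1 - kappa * (q0 * r%:R)) * m (E j))).
  apply: le_trans (miss _).
    apply: m_sub; first exact: mE.
      by apply: measurableI => //; apply: measurableC; exact: measurable_dep dN.
    move=> x [] ; rewrite addnS /blocks mkseqS rcons_uniq => /andP[nb ub] rs.
    split; first by split.
    rewrite /next_in /F /= => bs; move/negP: nb; apply.
    have : block (T + j) x \in seen q0 T x by [].
    by rewrite (seenE j) mem_filter => /andP[_]; exact: mem_take.
  move=> x [ub rs]; have us : uniq (seen q0 T x).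
    by rewrite (seenE j) filter_uniq// take_uniq.
  apply: le_trans (m_words_ge us (q0 := q0) _); last first.
    move=> w; rewrite mem_filter => /andP[qw wb]; split => //.
    by move/mapP: wb => [i _ ->]; exact: size_word.
  by rewrite ler_wpM2l// ler_nat.
set y := kappa * (q0 * r%:R).
apply: (@le_trans _ _ (expR (- y) * m (E j))).
  by rewrite ler_wpM2r ?m_ge0//; exact: expR_ge1Dx.
apply: (le_trans (ler_wpM2l (expR_ge0 _) IH)).
by rewrite -expRD -natr1 ler_expR -/y; lra.
Qed.

(** Two equal blocks form a repeat of length k. *)
Lemma norepeat_blocks N T x : (0 < k)%N -> (T * (k + g) <= N)%N ->
  ~ repeats k N x -> uniq (blocks T x).
Proof.
move=> kp TN nr; apply/negP => /negP /(uniqPn [::])[i [j [ij]]].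
rewrite size_mkseq => jT; rewrite !nth_mkseq// => [e|]; last exact: ltn_trans jT.
apply: nr; exists (i * (k + g) + g)%N, (j * (k + g) + g)%N; split => //.
rewrite ltn_add2r ltn_pmul2r ?ij ?addn_gt0 ?kp//=.
apply: (@leq_trans (j.+1 * (k + g))); last first.
  by apply: leq_trans TN; rewrite leq_mul2r jT orbT.
by rewrite mulSn -addnS addnC leq_add2r -addn1 addnC leq_add2r.
Qed.

Lemma m_norepeats q0 N T r : 0 <= q0 -> (0 < k)%N -> ((T + T) * (k + g) <= N)%N ->
  measurable (~` repeats k N : set (shift_space ne)) ->
  m (~` repeats k N) <=
  2 ^+ r * (1 - kappa * m (heavy k q0) / 2) ^+ T +
  expR (- (T%:R * (kappa * (q0 * r%:R)))).
Proof.
move=> q0_ge0 kp TN mN.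
have h1 := few_seen q0 T r; have h2 := no_later_repeat T r T q0_ge0.
apply: le_trans (lerD h1 h2).
have mf := measurable_few q0 T r.
rewrite (m_split mu mN mf); apply: lerD.
  by apply: m_sub => //; exact: measurableI.
apply: m_sub.
- by apply: measurableI => //; exact: measurableC.
- rewrite (_ : [set x | _ /\ _] = [set x | uniq (blocks (T + T) x)] `&`
      ~` [set x | (size (seen q0 T x) < r)%N]).
    apply: measurableI; last exact: measurableC.
    apply: (@measurable_dep _ _ _ ((T + T) * (k + g))).
    by move=> x y /word_blocks /= ->.
  apply/seteqP; split => x [/= ub rs]; split => //.
    by apply/negP; rewrite -leqNgt.
  by move/negP: rs; rewrite -leqNgt.
- move=> x [nr rs]; split; first exact: norepeat_blocks nr.
  by move/negP: rs; rewrite -leqNgt.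
Qed.

(** Balancing the two bounds: r is chosen proportional to the expected number of
heavy blocks, and then r q0 T is of the order of q0 q T^2. *)
Lemma m_norepeats_exp q0 N T Q : 0 < q0 -> (0 < k)%N ->
  ((T + T) * (k + g) <= N)%N ->
  measurable (~` repeats k N : set (shift_space ne)) ->
  8 <= kappa * Q -> Q ^+ 2 <= q0 * m (heavy k q0) * T%:R ^+ 2 ->
  m (~` repeats k N) <= 4 / (kappa * Q) + 8 / (kappa * Q) ^+ 2.
Proof.
move=> q0_gt0 kp TN mN kQ hQ; set q := m (heavy k q0).
have Q0 : 0 < Q by rewrite -(pmulr_rgt0 _ kappa0); apply: lt_le_trans kQ; rewrite ltr0n.
have q_gt0 : 0 < q.
  rewrite lt_neqAle m_ge0 andbT eq_sym; apply/eqP => qe0.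
  by move: hQ; rewrite -/q qe0 mulr0 mul0r leNgt exprn_gt0.
(* A single heavy word already has mass q0, whence q T >= Q as well. *)
have q0q : q0 <= q.
  have [x hx] : heavy k q0 !=set0.
    by apply/set0P/eqP => h0; move: q_gt0; rewrite /q h0 m0 ltxx.
  apply: (le_trans hx); apply: m_sub; [exact: measurable_cyl|exact: measurable_heavy|].
  by move=> y; rewrite cyl_word /heavy /= => ->.
have QqT : Q <= q * T%:R.
  rewrite -(@ler_pXn2r _ 2) ?nnegrE ?mulr_ge0 ?(ltW Q0) ?(ltW q_gt0)//.
  apply: (le_trans hQ); rewrite exprMn ler_wpM2r ?exprn_ge0// expr2.
  by rewrite -/q ler_wpM2r// ltW.
have [Y YE] : exists Y, Y = kappa * q * T%:R by exists (kappa * q * T%:R).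
have YQ : kappa * Q <= Y by rewrite YE -mulrA ler_pM2l.
have Y8 : 8 <= Y by apply: le_trans YQ.
(* 2^r is at most e^(Y / 4), half of the exponent of the first bound. *)
pose r := Num.truncn (Y / 4).
have /andP[r1 r2] : r%:R <= Y / 4 < r.+1%:R by apply: truncn_itv; lra.
have r3 : Y / 8 <= r%:R by move: r2; rewrite -[r.+1%:R]natr1; lra.
apply: (le_trans (m_norepeats r (ltW q0_gt0) kp TN mN)); rewrite -/q.
have q1 : q <= 1 by apply: m_le1; exact: measurable_heavy.
have inv_exp (t : R) : 0 < t -> expR (- t) <= t^-1.
  move=> t0; rewrite expRN lef_pV2 ?posrE ?expR_gt0//.
  by apply: le_trans (expR_ge1Dx t); rewrite lerDr.
have kQ0 : 0 < kappa * Q by exact: mulr_gt0.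
apply: lerD.
  apply: (@le_trans _ _ (expR r%:R * expR (- (Y / 2)))).
    apply: ler_pM.
    - by rewrite exprn_ge0.
    - rewrite exprn_ge0// subr_ge0.
      have : kappa * q <= 1 by rewrite -[1]mulr1 ler_pM// ltW.
      lra.
    - rewrite -[r%:R]mulr1 expRM_natl lerXn2r ?nnegrE ?expR_ge0//.
      by apply: le_trans (expR_ge1Dx 1).
    - have -> : - (Y / 2) = T%:R * (- (kappa * q / 2)) by rewrite YE; ring.
      rewrite expRM_natl lerXn2r ?nnegrE ?expR_ge0//.
        rewrite subr_ge0; have : kappa * q <= 1 by rewrite -[1]mulr1 ler_pM// ltW.
        lra.
      exact: expR_ge1Dx.
  rewrite -expRD; apply: (@le_trans _ _ (expR (- (Y / 4)))).
    by rewrite ler_expR; lra.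
  apply: (le_trans (inv_exp _ _)); first by lra.
  rewrite invf_div ler_pM2l// lef_pV2 ?posrE//; lra.
pose W := T%:R * (kappa * (q0 * r%:R)).
have W1 : (kappa * Q) ^+ 2 / 8 <= W.
  apply: (@le_trans _ _ (kappa * q0 * T%:R * (Y / 8))).
    rewrite exprMn; have -> : kappa * q0 * T%:R * (Y / 8) =
      kappa ^+ 2 / 8 * (q0 * q * T%:R ^+ 2) by rewrite YE; ring.
    by rewrite mulrAC ler_pM2l// divr_gt0// exprn_gt0.
  have -> : W = kappa * q0 * T%:R * r%:R by rewrite /W; ring.
  by rewrite ler_wpM2l// !mulr_ge0// ltW.
have W0 : 0 < (kappa * Q) ^+ 2 / 8 by rewrite divr_gt0// exprn_gt0.
apply: (le_trans (inv_exp W (lt_le_trans W0 W1))).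
by rewrite -invf_div lef_pV2 ?posrE//; exact: lt_le_trans W1.
Qed.

End blocks.
End repeats_lower.

(** * Almost sure estimates along exponential horizons *)

Section asymptotics.
Variables (R : realType) (I : countType) (A : rel I).
Variables (ne : [set: markov_shift A] !=set0).
Variable mu : probability (shift_space ne) R.
Local Notation p := (word_mass mu).
Local Notation m := (mass mu).
Local Notation z := (square_sum mu).
Hypothesis mixing : topologically_mixing A.
Hypothesis inv : shift_invariant mu.
Variable K : R.
Hypothesis qb : quasi_bernoulli mu K.
Variable H : R.
Hypothesis zH : (fun n => - ln (z n) / n%:R) @ \oo --> H.

Let K1 : 1 <= K. Proof. by case: qb. Qed.
Let K0 : 0 < K. Proof. exact: lt_le_trans K1. Qed.

(** The definition of the entropy in exponential form, on either side of H. *)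
Lemma z_le_exp h : h < H -> \forall k \near \oo, z k <= expR (- (k%:R * h)).
Proof.
move=> hH; have z0 := z_gt0 mixing inv qb.
near=> k; have k0 : (0 < k)%N by near: k; exact: nbhs_infty_gt.
have : h <= - ln (z k) / k%:R by near: k; apply: (cvgr_ge H).
rewrite ler_pdivlMr ?ltr0n// lerNr => hk.
by rewrite -[leLHS]lnK ?posrE// ler_expR mulrC.
Unshelve. all: by end_near. Qed.

Lemma z_ge_exp h : H < h -> \forall k \near \oo, expR (- (k%:R * h)) <= z k.
Proof.
move=> hH; have z0 := z_gt0 mixing inv qb.
near=> k; have k0 : (0 < k)%N by near: k; exact: nbhs_infty_gt.
have : - ln (z k) / k%:R <= h by near: k; apply: (cvgr_le H).
rewrite ler_pdivrMr ?ltr0n// lerNl => hk.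
by rewrite -[leRHS]lnK ?posrE// ler_expR mulrC.
Unshelve. all: by end_near. Qed.

Lemma poly_le_exp (g : nat) (C d : R) : 0 < C -> 0 < d ->
  \forall k \near \oo, C * (k + g)%N%:R ^+ 3 <= expR (k%:R * d).
Proof.
move=> C0 d0; near=> k.
have k0 : (0 < k)%N by near: k; exact: nbhs_infty_gt.
have kg : (g <= k)%N by near: k; exact: nbhs_infty_ge.
have kC : C * 8 / (d / 4) ^+ 4 <= k%:R by near: k; exact: nbhs_infty_ger.
have -> : expR (k%:R * d) = expR (k%:R * (d / 4)) ^+ 4.
  by rewrite -expRM_natl; congr expR; field.
have e1 : k%:R * (d / 4) <= expR (k%:R * (d / 4)).
  by apply: le_trans (expR_ge1Dx _); rewrite lerDr.
apply: (@le_trans _ _ ((k%:R * (d / 4)) ^+ 4)); last first.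
  by rewrite lerXn2r ?nnegrE ?expR_ge0// mulr_ge0// divr_ge0// ltW.
apply: (@le_trans _ _ (C * (2 * k%:R) ^+ 3)).
  rewrite ler_pM2l// lerXn2r ?nnegrE ?mulr_ge0//.
  by rewrite -natrM ler_nat mul2n -addnn leq_add2l.
have -> : C * (2 * k%:R) ^+ 3 = k%:R ^+ 3 * (C * 8) by ring.
have -> : (k%:R * (d / 4)) ^+ 4 = k%:R ^+ 3 * (k%:R * (d / 4) ^+ 4) by ring.
rewrite ler_pM2l ?exprn_gt0 ?ltr0n//.
by rewrite -ler_pdivrMr// exprn_gt0// divr_gt0.
Unshelve. all: by end_near. Qed.

(** The number of letters within which repeats of length k are looked for. The
critical rate is tau = H / 2. *)
Definition horizon (tau : R) (k : nat) : nat := Num.truncn (expR (k%:R * tau)).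

Lemma horizon_le tau k : (horizon tau k)%:R <= expR (k%:R * tau).
Proof. by rewrite truncn_le expR_ge0. Qed.

(** With z k about e^(-k h) and 2 tau < h, the two terms of the union bound are of
order e^(-2 k d) and k e^(-k d), where d = h / 2 - tau. *)
Lemma ae_no_repeats tau : 2 * tau < H ->
  {ae mu, forall x : shift_space ne,
    \forall k \near \oo, ~ repeats k (horizon tau k) x}.
Proof.
move=> tH; pose h := (H + 2 * tau) / 2.
have [d dE] : exists d, d = h / 2 - tau by exists (h / 2 - tau).
have d0 : 0 < d by rewrite dE /h; lra.
have hH : h < H by rewrite /h; lra.
have [k0 _ hk0] := z_le_exp hH.
have C0 : 0 < K ^+ 2 + 2 * K / d by rewrite addr_gt0 ?exprn_gt0 ?divr_gt0 ?mulr_gt0.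
have d20 : 0 < d / 2 by rewrite divr_gt0.
apply: (@borel_cantelli_exp _ _ _ _ mu _ _ _ k0 _ C0 d20).
  by move=> k; exact: (m_repeats mixing inv qb _ _).1.
move=> k kk0; apply: (le_trans (m_repeats mixing inv qb _ _).2).
have {hk0}zk := hk0 k kk0.
set N := horizon tau k; have NE := horizon_le tau k; rewrite -/N in NE.
have sz : Num.sqrt (z k) <= expR (- (k%:R * (h / 2))).
  rewrite -[leRHS]ger0_norm ?expR_ge0// -sqrtr_sqr ler_wsqrtr//.
  by rewrite -expRM_natl; apply: le_trans zk _; rewrite ler_expR; lra.
have N2 : N%:R ^+ 2 <= expR (k%:R * (2 * tau)).
  have -> : expR (k%:R * (2 * tau)) = expR (k%:R * tau) ^+ 2.
    by rewrite -expRM_natl; congr expR; ring.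
  by rewrite lerXn2r ?nnegrE ?expR_ge0.
have kR : (0 : R) <= k%:R by [].
rewrite mulrDl; apply: lerD.
  rewrite mulrCA ler_pM2l ?exprn_gt0//.
  apply: (le_trans (ler_pM (exprn_ge0 _ _) (z_ge0 _ _) N2 zk)) => //.
  rewrite -expRD ler_expR.
  have -> : k%:R * (2 * tau) - k%:R * h = - (k%:R * (2 * d)) by rewrite dE; field.
  by rewrite lerN2 ler_wpM2l//; lra.
have kexp : k%:R <= 2 / d * expR (k%:R * (d / 2)).
  rewrite mulrC -ler_pdivrMr ?divr_gt0// invf_div.
  by apply: le_trans (expR_ge1Dx _); rewrite lerDr.
have Ns : N%:R * Num.sqrt (z k) <= expR (- (k%:R * d)).
  apply: (le_trans (ler_pM _ (sqrtr_ge0 _) NE sz)) => //.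
  by rewrite -expRD ler_expR dE; lra.
have -> : N%:R * (k%:R * (K * Num.sqrt (z k))) =
  K * (k%:R * (N%:R * Num.sqrt (z k))) by ring.
have -> : 2 * K / d * expR (- (k%:R * (d / 2))) =
  K * (2 / d * expR (k%:R * (d / 2)) * expR (- (k%:R * d))).
  have -> : expR (- (k%:R * (d / 2))) = expR (k%:R * (d / 2)) * expR (- (k%:R * d)).
    by rewrite -expRD; congr expR; field.
  by ring.
by rewrite ler_pM2l// ler_pM// mulr_ge0// sqrtr_ge0.
Qed.

(** With T of the order of e^(k tau) / k and q0 q at least of the order of
e^(-k h) / k, the product q0 q T^2 exceeds e^(k d) for large k, where
d = (2 tau - h) / 2 absorbs the polynomial factors. *)
Lemma ae_repeats tau : 0 < H -> H < 2 * tau ->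
  {ae mu, forall x : shift_space ne,
    \forall k \near \oo, repeats k (horizon tau k) x}.
Proof.
move=> H0 tH.
have [g [kappa [/andP[kp0 kp1] meet]]] := m_meet_ge mixing inv qb.
have [h hE] : exists h, h = (H + 2 * tau) / 2 by exists ((H + 2 * tau) / 2).
have hH : H < h by rewrite hE; lra.
have [d dE] : exists d, d = (2 * tau - h) / 2 by exists ((2 * tau - h) / 2).
have d0 : 0 < d by rewrite dE hE; lra.
have t0 : 0 < tau by lra.
have d20 : 0 < d / 2 by rewrite divr_gt0.
have [B hB] : exists B : nat, h + 1 <= B%:R.
  by exists (Num.bound (h + 1)); apply/ltW/archi_boundP; lra.
have B0 : 0 < B%:R :> R by lra.
have e0 : 0 < expR 1 :> R by exact: expR_gt0.
have e2 : 2 <= expR 1 :> R by exact: expR_ge1Dx.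
have mR k N : measurable (repeats k N : set (shift_space ne)).
  exact: (m_repeats mixing inv qb _ _).1.
have C0 : 0 < 12 / kappa by rewrite divr_gt0.
have C1 : 0 < 32 * expR 1 * B%:R :> R by rewrite !mulr_gt0.
have C2 : 0 < 8 / kappa by rewrite divr_gt0.
have [k0 _ hk0] : \forall k \near \oo,
    m (~` repeats k (horizon tau k)) <= 12 / kappa * expR (- (k%:R * (d / 2))).
  near=> k.
  have kpos : (0 < k)%N by near: k; exact: nbhs_infty_gt.
  have k1 : 1 <= k%:R :> R by rewrite ler1n.
  have zk : expR (- (k%:R * h)) <= z k by near: k; exact: z_ge_exp.
  have hC1 : 32 * expR 1 * B%:R * (k + g)%N%:R ^+ 3 <= expR (k%:R * d).
    by near: k; exact: poly_le_exp.
  have hC2 : 8 / kappa * (k + g)%N%:R ^+ 3 <= expR (k%:R * (d / 2)).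
    by near: k; exact: poly_le_exp.
  have hC3 : 4 * (k + g)%N%:R ^+ 3 <= expR (k%:R * tau).
    by near: k; exact: poly_le_exp.
  have [s sE] : exists s : R, s = (k + g)%N%:R by exists (k + g)%N%:R.
  rewrite -sE in hC1 hC2 hC3.
  have s1 : 1 <= s by rewrite sE ler1n addn_gt0 kpos.
  have ks : k%:R <= s by rewrite sE ler_nat leq_addr.
  have s0 : 0 < s by exact: lt_le_trans s1.
  have ss3 : s <= s ^+ 3 by rewrite exprS ler_peMr ?(ltW s0)// exprn_ege1.
  (* L is linear in k with a slope above h, so e^-L is negligible against z k. *)
  pose L := (k * B)%N.
  have L0 : (0 < L)%N by rewrite muln_gt0 kpos -(ltr0n R).
  have zL : 2 * expR (- L%:R) <= z k.
    apply: le_trans zk; rewrite -ler_pdivlMl//.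
    apply: (@le_trans _ _ (expR (- (k%:R * h)) * expR (- k%:R))).
      rewrite -expRD ler_expR /L natrM.
      have : k%:R * (h + 1) <= k%:R * B%:R by rewrite ler_wpM2l.
      by rewrite mulrDr mulr1; lra.
    rewrite mulrC ler_pM2r ?expR_gt0// expRN lef_pV2 ?posrE ?expR_gt0//.
    by apply: (le_trans e2); rewrite ler_expR.
  have [q0 [q00 hq]] := heavy_level L0 zL.
  pose E := expR (k%:R * tau).
  have E0 : 0 < E by exact: expR_gt0.
  pose T := Num.truncn (E / (2 * s)).
  have Es0 : 0 <= E / (2 * s) by rewrite divr_ge0 ?mulr_ge0// ltW.
  have /andP[T1 T2] := truncn_itv Es0; rewrite -/T in T1 T2.
  have Es1 : 1 <= E / (4 * s).
    rewrite ler_pdivlMr ?mulr_gt0// mul1r; apply: le_trans hC3.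
    by rewrite ler_pM2l.
  have T3 : E / (4 * s) <= T%:R.
    have -> : E / (4 * s) = E / (2 * s) - E / (4 * s) by field; rewrite gt_eqF.
    by rewrite -[T.+1%:R]natr1 in T2; lra.
  have TN : ((T + T) * (k + g) <= horizon tau k)%N.
    rewrite truncn_ge_nat ?expR_ge0// natrM natrD -sE -/E.
    by move: T1; rewrite ler_pdivlMr ?mulr_gt0//; lra.
  pose Q := expR (k%:R * (d / 2)).
  have kQ : 8 <= kappa * Q.
    rewrite -ler_pdivrMl// mulrC; apply: le_trans hC2.
    by rewrite -[leLHS]mulr1 ler_pM2l// exprn_ege1.
  have hQ : Q ^+ 2 <= q0 * m (heavy mu k q0) * T%:R ^+ 2.
    apply: (@le_trans _ _
      (z k / (2 * expR 1 * L%:R) * (E / (4 * s)) ^+ 2)); last first.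
      apply: ler_pM => //.
      - by rewrite divr_ge0 ?z_ge0// !mulr_ge0// ltW.
      - by rewrite exprn_ge0// (le_trans _ Es1).
      - by rewrite lerXn2r ?nnegrE// (le_trans _ Es1).
    apply: (@le_trans _ _ (expR (- (k%:R * h)) / (2 * expR 1 * L%:R) *
      (E / (4 * s)) ^+ 2)); last first.
      apply: ler_wpM2r; first by rewrite exprn_ge0// (le_trans _ Es1).
      by apply: ler_wpM2r => //; rewrite invr_ge0 !mulr_ge0// ltW.
    have -> : Q ^+ 2 = expR (k%:R * d) by rewrite -expRM_natl; congr expR; field.
    have -> : expR (- (k%:R * h)) / (2 * expR 1 * L%:R) * (E / (4 * s)) ^+ 2 =
        expR (k%:R * d) ^+ 2 / (32 * expR 1 * B%:R * (k%:R * s ^+ 2)).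
      have -> : expR (k%:R * d) ^+ 2 = expR (- (k%:R * h)) * E ^+ 2.
        by rewrite -!expRM_natl -expRD; congr expR; rewrite dE; field.
      by rewrite /L natrM; field; rewrite !gt_eqF// ltr0n.
    rewrite ler_pdivlMr; last by rewrite mulr_gt0// mulr_gt0 ?exprn_gt0 ?ltr0n.
    rewrite [leRHS]expr2 ler_pM2l ?expR_gt0//; apply: le_trans hC1.
    by rewrite ler_pM2l// [s ^+ 3]exprS ler_pM2r ?exprn_gt0.
  apply: (le_trans (m_norepeats_exp kp0 kp1 meet q00 kpos TN _ kQ hQ)).
    exact: measurableC.
  have kQ0 : 0 < kappa * Q by apply: lt_le_trans kQ; rewrite ltr0n.
  have -> : 12 / kappa * expR (- (k%:R * (d / 2))) = 4 / (kappa * Q) + 8 / (kappa * Q).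
    by rewrite expRN -/Q; field; rewrite !gt_eqF// expR_gt0.
  rewrite lerD2l ler_pM2l// lef_pV2 ?posrE ?exprn_gt0// expr2 ler_pMl//.
  by apply: le_trans kQ; rewrite ler1n.
have := @borel_cantelli_exp _ _ _ _ mu (fun k => ~` repeats k (horizon tau k)) _ _ k0
  (fun k => measurableC (mR k _)) C0 d20 (fun k h => hk0 k h).
apply: filterS => x; apply: filterS => k /contrapT; exact.
Unshelve. all: by end_near. Qed.

End asymptotics.

(** * The longest repeat *)

Section longest_repeats.
Variables (R : realType) (I : countType) (A : rel I).
Implicit Types (x y : markov_shift A).

Lemma repeat_lengthsE n k x : (0 < n)%N -> repeat_lengths n x k <-> repeats k n x.
Proof.
move=> n0; have e l : (l <= n.-1)%N = (l < n)%N by rewrite -[in LHS]ltnS prednK.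
split => -[i [j [ij h]]]; exists i, j; split.
- by rewrite -e.
- by apply/wordP => l lk; rewrite !shE h.
- by rewrite e.
- by move=> l lk; move/wordP: h => /(_ l lk); rewrite !shE.
Qed.

Lemma repeats_le k k' n n' x : (k' <= k)%N -> (n <= n')%N ->
  repeats k n x -> repeats k' n' x.
Proof.
move=> kk nn [i [j [/andP[ij jn] r]]]; exists i, j; split.
  by rewrite ij (leq_trans jn nn).
exact: word_le kk r.
Qed.

(** Repeat lengths form an initial segment, so one length that occurs and one that
does not enclose the maximum, which is then attained. *)
Lemma longest_repeat_bounds n k k' x : (1 < n)%N ->
  repeats k n x -> ~ repeats k' n x ->
  exists M : nat, longest_repeat R n x = (M%:R)%:E /\ (k <= M < k')%N.
Proof.
move=> n1 rk nrk'; have n0 : (0 < n)%N by exact: ltnW.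
have lt_k' l : repeats l n x -> (l < k')%N.
  by move=> rl; rewrite ltnNge; apply/negP => kl; apply: nrk'; exact: repeats_le rl.
pose P l := `[< repeats l n x >].
have exP : exists l, P l by exists k; apply/asboolP.
have ubP l : P l -> (l <= k')%N by move=> /asboolP /lt_k' /ltnW.
case: (ex_maxnP exP ubP) => M /asboolP rM maxM.
exists M; split; last by rewrite (maxM k) ?lt_k'//; apply/asboolP.
have inK : [set (l%:R)%:E | l in repeat_lengths n x] ((M%:R)%:E : \bar R).
  by exists M => //; apply/repeat_lengthsE.
apply: xget_unique.
  split => // _ [l /(repeat_lengthsE _ _ n0) rl <-]; rewrite lee_fin ler_nat maxM//.
  by apply/asboolP; exact: rl.
move=> _ [[l /(repeat_lengthsE _ _ n0) rl <-] ub]; congr (_%:R%:E).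
apply/eqP; rewrite eqn_leq maxM; last by apply/asboolP; exact: rl.
by have := ub _ inK; rewrite lee_fin ler_nat.
Qed.

(** Reading the two families of bounds along the horizons e^(k tau) at
k close to log n / tau. *)
Lemma longest_repeat_cvg (H : R) x : 0 < H ->
  (forall j, \forall k \near \oo,
     ~ repeats k (horizon (H / 2 * (j.+1%:R / j.+2%:R)) k) x) ->
  (forall j, \forall k \near \oo,
     repeats k (horizon (H / 2 * (j.+2%:R / j.+1%:R)) k) x) ->
  (fun n => longest_repeat R n x / (ln n%:R)%:E)%E @ \oo --> (2%:E / H%:E)%E.
Proof.
move=> H0 up lo.
have key e : 0 < e -> \forall n \near \oo, exists M : nat,
    longest_repeat R n x = (M%:R)%:E /\ `|2 / H - M%:R / ln n%:R| <= e.
  move=> e0; have [j hj] : exists j : nat, 2 / H / j.+1%:R <= e / 2.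
    have [j hj] : exists j : nat, 2 / H / (e / 2) < j%:R.
      exists (Num.bound (2 / H / (e / 2))).
      by rewrite archi_boundP// !divr_ge0// ltW.
    exists j; rewrite ler_pdivrMr ?ltr0n// [leRHS]mulrC -ler_pdivrMr ?divr_gt0//.
    by apply: ltW; apply: lt_le_trans hj _; rewrite ler_nat.
  have [ku _ hku] := up j; have [kl _ hkl] := lo j.
  have j1 : (0 : R) < j.+1%:R by rewrite ltr0n.
  have j2 : (0 : R) < j.+2%:R by rewrite ltr0n.
  have jj : j.+2%:R = j.+1%:R + 1 :> R by rewrite -natr1.
  move: hku hkl; move: (j.+2%:R) (j.+1%:R) j1 j2 jj hj => b a a0 b0 ab hj hku hkl.
  set tu := H / 2 * (a / b) in hku; set tl := H / 2 * (b / a) in hkl.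
  have tu0 : 0 < tu by rewrite mulr_gt0// divr_gt0.
  have tl0 : 0 < tl by rewrite mulr_gt0// divr_gt0.
  (* b = a + 1, so the inverse rates exceed or miss 2 / H by O(1 / a). *)
  have tuE : tu^-1 = 2 / H + 2 / H / a.
    by rewrite /tu ab; field; rewrite -ab !gt_eqF.
  have tlE : tl^-1 = 2 / H - 2 / H / b.
    by rewrite /tl ab; field; rewrite -ab !gt_eqF.
  near=> n.
  have n1 : (1 < n)%N by near: n; exact: nbhs_infty_gt.
  have n0 : (0 : R) < n%:R by rewrite ltr0n ltnW.
  have lnge (C : R) : expR C <= n%:R -> C <= ln n%:R.
    by move=> h; rewrite -[C]expRK ler_ln ?posrE ?expR_gt0.
  have l1 : 2 / e <= ln n%:R by apply: lnge; near: n; exact: nbhs_infty_ger.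
  have l2 : ku%:R * tu <= ln n%:R by apply: lnge; near: n; exact: nbhs_infty_ger.
  have l3 : (kl.+1)%:R * tl <= ln n%:R by apply: lnge; near: n; exact: nbhs_infty_ger.
  have ln0 : 0 < ln n%:R :> R by apply: lt_le_trans l1; rewrite divr_gt0.
  have du0 : 0 <= ln n%:R / tu by rewrite divr_ge0// ltW.
  have dl0 : 0 <= ln n%:R / tl by rewrite divr_ge0// ltW.
  have /andP[u1 u2] := truncn_itv du0; have /andP[v1 v2] := truncn_itv dl0.
  move: (Num.truncn (ln n%:R / tu)) (Num.truncn (ln n%:R / tl)) u1 u2 v1 v2.
  move=> u v u1 u2 v1 v2.
  have rv : repeats v n x.
    have : repeats v (horizon tl v) x.
      apply: hkl => /=; rewrite -ltnS -(ltr_nat R).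
      apply: le_lt_trans v2; rewrite ler_pdivlMr//; apply: le_trans l3.
      by rewrite ler_pM2r// ler_nat.
    apply: repeats_le => //; rewrite -(ler_nat R).
    apply: (le_trans (horizon_le _ _)).
    by rewrite -[leRHS]lnK ?posrE// ler_expR -ler_pdivlMr.
  have ru : ~ repeats u.+1 n x.
    have : ~ repeats u.+1 (horizon tu u.+1) x.
      apply: hku => /=; rewrite -(ler_nat R) ltW//; apply: le_lt_trans u2.
      by rewrite ler_pdivlMr.
    apply: contra_not; apply: repeats_le => //.
    rewrite truncn_ge_nat ?expR_ge0// -[leLHS]lnK ?posrE// ler_expR.
    by rewrite -ler_pdivrMr// ltW.
  have [M [-> /andP[vM Mu]]] := longest_repeat_bounds n1 rv ru.
  exists M; split => //.
  have il : (ln n%:R)^-1 <= e / 2 by rewrite -invf_div lef_pV2 ?posrE ?divr_gt0.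
  have M1 : M%:R / ln n%:R <= tu^-1.
    rewrite ler_pdivrMr// mulrC; apply: le_trans u1.
    by rewrite ler_nat -ltnS.
  have M2 : tl^-1 - (ln n%:R)^-1 <= M%:R / ln n%:R.
    rewrite ler_pdivlMr// mulrBl mulVf ?gt_eqF// lerBlDr mulrC.
    by apply: (le_trans (ltW v2)); rewrite -[v.+1%:R]natr1 lerD2r ler_nat.
  have ba : 2 / H / b <= 2 / H / a.
    rewrite ler_pM2l ?divr_gt0// lef_pV2 ?posrE//; lra.
  rewrite tuE in M1; rewrite tlE in M2.
  rewrite ler_distl; lra.
have -> : (2%:E / H%:E)%E = (2 / H)%:E by rewrite inver gt_eqF.
have val n M : (1 < n)%N -> longest_repeat R n x = (M%:R)%:E ->
    (longest_repeat R n x / (ln n%:R)%:E)%E = (M%:R / ln n%:R)%:E.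
  move=> n1 ->; rewrite inver gt_eqF// ln_gt0// -[1]/(1%:R) ltr_nat//.
apply: cvg_EFin.
  near=> n; have n1 : (1 < n)%N by near: n; exact: nbhs_infty_gt.
  have [M [hM _]] : exists M : nat,
    longest_repeat R n x = (M%:R)%:E /\ `|2 / H - M%:R / ln n%:R| <= 1.
    by near: n; exact: key.
  by rewrite (val _ _ n1 hM).
apply/cvgrPdist_le => e e0; near=> n.
have n1 : (1 < n)%N by near: n; exact: nbhs_infty_gt.
have [M [hM h]] : exists M : nat,
    longest_repeat R n x = (M%:R)%:E /\ `|2 / H - M%:R / ln n%:R| <= e.
  by near: n; exact: key.
by rewrite /= (val _ _ n1 hM).
Unshelve. all: by end_near. Qed.

(** With a single symbol every length is a repeat length, and the default value of
the maximum is +oo. *)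
Lemma longest_repeat_constant n x : (1 < n)%N -> (forall a b : I, a = b) ->
  longest_repeat R n x = +oo%E.
Proof.
move=> n1 ab; rewrite /longest_repeat /=; case: xgetP => // _ -> [[k _ <-]] ub.
have /ub : [set (l%:R)%:E | l in repeat_lengths n x] ((k.+1%:R)%:E : \bar R).
  by exists k.+1 => //; exists 0%N, 1%N; split; [lia|move=> l _; exact: ab].
by rewrite lee_fin ler_nat ltnn.
Qed.

End longest_repeats.

(* In \bar R, 0^-1 = +oo, so 2 / H_2 = +oo when H_2 = 0. *)
Theorem theorem1p1 (R : realType) (I : countType) (A : rel I)
    (ne : [set: markov_shift A] !=set0)
    (mixing : topologically_mixing A)
    (phi : markov_shift A -> R) (holder : locally_holder phi)
    (mu : probability (shift_space ne) R) (gibbs : gibbs_measure phi mu) :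
  {ae mu, forall x : shift_space ne,
    (fun n : nat => (longest_repeat R n x / (ln n%:R)%:E)%E) @ \oo
      --> (2%:E / renyi_entropy mu)%E}.
Proof.
have [K qb] := gibbs_quasi_bernoulli gibbs.
have inv : shift_invariant mu by case: gibbs.
have [H [Hpos zH ->]] := entropy_exists mixing inv qb.
have [[a [b ab]]|single] := pselect (exists a b : I, a != b).
  have H0 := Hpos a b ab.
  have up : {ae mu, forall x : shift_space ne, forall j, \forall k \near \oo,
      ~ repeats k (horizon (H / 2 * (j.+1%:R / j.+2%:R)) k) x}.
    apply: ae_foralln => j; apply: (ae_no_repeats mixing inv qb zH).
    rewrite mulrA [2 * _]mulrC divfK// gtr_pMr// ltr_pdivrMr ?ltr0n// mul1r.
    by rewrite ltr_nat.
  have lo : {ae mu, forall x : shift_space ne, forall j, \forall k \near \oo,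
      repeats k (horizon (H / 2 * (j.+2%:R / j.+1%:R)) k) x}.
    apply: ae_foralln => j; apply: (ae_repeats mixing inv qb zH) => //.
    rewrite mulrA [2 * _]mulrC divfK// ltr_pMr// ltr_pdivlMr ?ltr0n// mul1r.
    by rewrite ltr_nat.
  by apply: filterS2 up lo => x; exact: longest_repeat_cvg.
have all_eq (a b : I) : a = b.
  by apply: contrapT => ab; apply: single; exists a, b; apply/eqP.
have z1 n : square_sum mu n = 1.
  have [x0 _] := ne; apply/eqP; rewrite eq_le; apply/andP; split.
    by apply: z_le => // w _; apply: m_le1; exact: measurable_cyl.
  have := p_le_z mu (word n x0); rewrite size_word; apply: le_trans.
  rewrite /word_mass (_ : cyl _ = setT) ?mT ?expr1n//.
  by apply/seteqP; split => // y _; rewrite cyl_word /=; apply/wordP.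
have -> : H = 0.
  have : (fun n => - ln (square_sum mu n) / n%:R) @ \oo --> (0 : R).
    under eq_fun do rewrite z1 ln1 oppr0 mul0r; exact: cvg_cst.
  by move=> z0; exact: cvg_unique zH z0.
rewrite inve0 gt0_muley ?lte_fin//.
have c : (fun=> +oo%E) @ \oo --> (+oo%E : \bar R) by exact: cvg_cst.
apply: aeW => x; apply: cvg_trans c; apply: near_eq_cvg; near=> n.
have n1 : (1 < n)%N by near: n; exact: nbhs_infty_gt.
have l0 : 0 < ln n%:R :> R by rewrite ln_gt0// -[1]/(1%:R) ltr_nat.
by rewrite longest_repeat_constant// inver gt_eqF// gt0_mulye// lte_fin invr_gt0.
Unshelve. all: by end_near. Qed.
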